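(* Assume (A1), (A2), (A3). Then: 1) for every $n\in\mathbb N$, $\inf_{\theta\in\Theta}\mathcal R(\hat F_{n,\theta})-\inf_{\theta\in\Theta}\mathcal R(F_\theta)$ is a (real-valued) random variable on $(\Omega,\mathcal F,\mathbb P)$; 2) the set $\operatorname{argmin}\mathcal R$ and the sets $M_{F_\theta}$ ($\theta\in\Theta$) are nonempty and compact; 3) there is $A\in\mathcal F$ with $\mathbb P(A)=1$ such that $\inf_{\theta\in\Theta}\mathcal R(\hat F_{n,\theta})(\omega)\to\inf_{\theta\in\Theta}\mathcal R(F_\theta)$ as $n\to\infty$ for every $\omega\in A$.
   Context: Standing setup: $(\Omega,\mathcal F,\mathbb P)$ is an atomless probability space; $\Theta\subseteq\mathbb R^m$ is nonempty and compact; $Z_1,Z_2,\dots$ are independent $\mathbb R^d$-valued random vectors on $\Omega$, all with law $\mathbb P^Z$; $G:\Theta\times\mathbb R^d\to\mathbb R$. $\Phi:[0,\infty[\to[0,\infty]$ is lower semicontinuous and convex with $\Phi(0)<\infty$, $\Phi(x_0)<\infty$ for some $x_0>1$, $\inf_{x\ge0}\Phi(x)=0$ and $\lim_{x\to\infty}\Phi(x)/x=\infty$. Its Fenchel–Legendre transform $\Phi^*(y)=\sup_{x\ge0}(xy-\Phi(x))$ ($y\in\mathbb R$) is finite, convex, nondecreasing, with $\Phi^*(0)=0$ and $\Phi^*\ge-\Phi(0)$. The Orlicz heart is $H^{\Phi^*}=\{X\text{ real random variable}:\ \mathbb E[\Phi^*(c|X|)]<\infty\ \forall c>0\}$. For a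 distribution function $F$ (of a random variable in $H^{\Phi^*}$, or an empirical distribution function) with left-continuous quantile function $F^\leftarrow$, set $\mathcal R(F)=\inf_{x\in\mathbb R}\big(\int_0^1\Phi^*(F^\leftarrow(u)+x)\,du-x\big)$ and let $M_F$ be the set of $x$ attaining this infimum. $F_\theta$ is the distribution function of $G(\theta,Z_1)$ and $\hat F_{n,\theta}(t)=\frac1n\sum_{j=1}^n\mathbb 1_{]-\infty,t]}(G(\theta,Z_j))$, so that $\mathcal R(\hat F_{n,\theta})=\inf_{x\in\mathbb R}\big(\frac1n\sum_{i=1}^n\Phi^*(G(\theta,Z_i)+x)-x\big)$. $\operatorname{argmin}\mathcal R$ denotes the set of minimizers of $\theta\mapsto\mathcal R(F_\theta)$ on $\Theta$. Assumptions: (A1) $G$ is $\mathcal B(\Theta)\otimes\mathcal B(\mathbb R^d)$-measurable and $G(\cdot,z)$ is lower semicontinuous for every $z\in\mathbb R^d$. (A2) There is a $\mathbb P^Z$-integrable $\xi_1:\mathbb R^d\to\mathbb R$ with $\sup_{\theta\in\Theta}|G(\theta,z)|\le\xi_1(z)$ for all $z$. (A3) $G(\theta,Z_1)\in H^{\Phi^*}$ for every $\theta\in\Theta$, and there is a $\mathbb P^Z$-integrable $\xi_2:\mathbb R^d\to\mathbb R$ with $\sup_{\theta\in\Theta}|\Phi^*(G(\theta,z))|\le\xi_2(z)$ for all $z$. *)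

(* Defs.v *)
From HB Require Import structures.
From mathcomp Require Import all_boot all_order all_algebra.
From mathcomp Require Import all_classical all_reals all_analysis.
From mathcomp Require Import measurable_realfun.
From mathcomp Require Import finmap.
Set Implicit Arguments.
Unset Strict Implicit.
Unset Printing Implicit Defensive.
Import Order.TTheory GRing.Theory Num.Theory.
Import numFieldNormedType.Exports.
Local Open Scope classical_set_scope.
Local Open Scope ring_scope.

Definition Borel_rV (R : realType) (n : nat) :=
  g_sigma_algebraType (@open 'rV[R]_n).

Definition atomless {dO : measure_display} {Omega : measurableType dO}
  {R : realType} (P : probability Omega R) : Prop :=
  forall A : set Omega, measurable A -> (0 < P A)%E ->
    exists B : set Omega, [/\ measurable B, B `<=` A, (0 < P B)%E & (P B < P A)%E].

Definition mutually_independent {dO : measure_display} {Omega : measurableType dO}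
  {R : realType} (P : probability Omega R) {dT : measure_display}
  {T : measurableType dT} (Z : nat -> Omega -> T) : Prop :=
  forall (J : {fset nat}) (B : nat -> set T),
    (forall j, j \in J -> measurable (B j)) ->
    P (\bigcap_(j in [set` J]) (Z j @^-1` B j)) =
    (\prod_(j <- J) P (Z j @^-1` B j))%E.

Definition lsc_on {R : realType} {T : pseudoMetricType R} (D : set T)
  (f : T -> \bar R) : Prop :=
  forall x, D x -> forall a : \bar R, (a < f x)%E ->
    exists2 e : R, 0 < e & forall y, D y -> ball x e y -> (a < f y)%E.

Definition convex_on_nonneg {R : realType} (Phi : R -> \bar R) : Prop :=
  forall x y t : R, 0 <= x -> 0 <= y -> 0 <= t <= 1 ->
    (Phi (t * x + (1 - t) * y)%R <= t%:E * Phi x + (1 - t)%R%:E * Phi y)%E.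

Definition admissible_Phi {R : realType} (Phi : R -> \bar R) : Prop :=
  [/\ (forall x, 0 <= x -> (0 <= Phi x)%E),
      lsc_on [set x : R | 0 <= x] Phi,
      convex_on_nonneg Phi,
      (Phi 0%R < +oo)%E &
      (exists2 x0 : R, 1 < x0 & (Phi x0 < +oo)%E)] /\
  (ereal_inf [set Phi x | x in [set x : R | 0 <= x]] = 0%E) /\
  ((Phi x * (x^-1)%:E)%E @[x --> +oo] --> +oo%E).

(* Fenchel-Legendre transform Phi^*(y) = sup_{x >= 0} (x y - Phi x)
   (finite under the standing assumptions, hence taken as a real) *)
Definition Phistar {R : realType} (Phi : R -> \bar R) (y : R) : R :=
  fine (ereal_sup [set ((x * y)%:E - Phi x)%E | x in [set x : R | 0 <= x]]).

Definition orlicz_heart {dO : measure_display} {Omega : measurableType dO}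
  {R : realType} (P : probability Omega R) (Phi : R -> \bar R)
  (X : Omega -> R) : Prop :=
  measurable_fun setT X /\
  forall c : R, 0 < c -> (\int[P]_w (Phistar Phi (c * `|X w|))%:E < +oo)%E.

Definition distr_fun {dO : measure_display} {Omega : measurableType dO}
  {R : realType} (P : probability Omega R) (X : Omega -> R) (t : R) : R :=
  fine (P (X @^-1` `]-oo, t])).

Definition emp_distr_fun {R : realType} (n : nat) (x : nat -> R) (t : R) : R :=
  n%:R^-1 * \sum_(j < n) \1_(`]-oo, t]) (x j).

Definition quantile {R : realType} (F : R -> R) (u : R) : R :=
  inf [set t : R | u <= F t].

Definition risk_obj {R : realType} (Phi : R -> \bar R) (F : R -> R) (x : R)
  : \bar R :=
  ((\int[@lebesgue_measure R]_(u in `]0%R, 1%R[) (Phistar Phi (quantile F u + x)%R)%:E)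
    - x%:E)%E.

Definition risk {R : realType} (Phi : R -> \bar R) (F : R -> R) : \bar R :=
  ereal_inf [set risk_obj Phi F x | x in [set: R]].

Definition minimizers {R : realType} (Phi : R -> \bar R) (F : R -> R) : set R :=
  [set x : R | risk_obj Phi F x = risk Phi F].

(* Main.v *)
Require Import Defs.
From HB Require Import structures.
From mathcomp Require Import finmap.
From mathcomp Require Import all_boot all_order all_algebra.
From mathcomp Require Import all_classical all_reals all_analysis.
From mathcomp Require Import measurable_realfun.
From mathcomp Require Import ring lra.
From Stdlib Require List.
Set Implicit Arguments.
Unset Strict Implicit.
Unset Printing Implicit Defensive.
Import Order.TTheory GRing.Theory Num.Theory.
Import numFieldNormedType.Exports.
Local Open Scope classical_set_scope.
Local Open Scope ring_scope.

(** The quantile transform turns R(F_theta) and R(hat F_(n,theta)) into the infima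
    over x of the mean and of the empirical mean of the loss
    h(theta,x,z) = Phi^*(G(theta,z) + x) - x.

    If the mean of h is above a on Theta x R, then near each point h dominates
    an integrable function of z alone whose mean is above a: replace G by its
    infimum over a small ball and use lower semicontinuity, monotonicity of Phi^*
    and dominated convergence.  The growth of Phi^* does the same for large |x|.
    By compactness finitely many such minorants suffice.  This gives
    the minimizers, and the strong law for these finitely many functions gives
    the lower bound for the empirical infima; the upper bound is the strong law at
    a minimizer.

    As Omega need not be complete, infima over theta are measurable because
    Borel sets with compact sections have Borel projections; this follows from
    Novikov's separation theorem for sequences of analytic sets.  The strong law
    is proved by Garsia's maximal argument. *)

(** * Analytic sets and projections along a compact factor *)

(** Two infima over [theta] are uncountable: that of the empirical loss, and that of [G] over a
    small ball inside the minorants. As [G] is only lower semicontinuous in [theta], a countable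
    dense set of parameters gives neither of them; this is why a projection theorem is needed. It is
    applied in Euclidean space only: a sample of size [n] is flattened to one vector, the projection
    is Borel there, and only then is it pulled back to [Omega]. The variable [x] is easier: since
    [Phistar] is nondecreasing, replacing [x] by a smaller rational [q] raises the loss by at most
    [x - q]. The constants come from [Phi]. A point [x0 > 1] with finite [Phi x0] makes [Phistar]
    grow faster than [x], which confines near minimizers to bounded [x]. Combined with the finite
    [Phi 0] it gives a minorant of slope one, hence a lower bound of the loss that does not depend
    on [x]. The Orlicz heart enters with the factor 2, through midpoint convexity. *)

Section Suslin.
Context {W : Type}.

(** Each [C k] is locally constant on Baire space, instead of a function of the first [k] terms.
    Branches can then be recoded freely, without tracking how long a prefix each set reads. *)
Definition locally_determined (C : nat -> (nat -> nat) -> set W) :=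
  forall k s, exists N, forall t, (forall i, (i < N)%N -> t i = s i) ->
    C k t = C k s.

(** Suslin's operation A; fed with compact sets, as below, it produces analytic sets. *)
Definition suslin_op (C : nat -> (nat -> nat) -> set W) : set W :=
  [set x | exists s, forall k, C k s x].

Definition suslin (Q : set (set W)) (S : set W) :=
  exists C, [/\ locally_determined C, forall k s, Q (C k s) & S = suslin_op C].

Lemma suslin_basic (Q : set (set W)) S : Q S -> suslin Q S.
Proof.
move=> QS; exists (fun _ _ => S); split => //; first by move=> k s; exists 0%N.
by apply/seteqP; split => [x Sx|x [s /(_ 0%N)//]]; exists (fun=> 0%N).
Qed.

(** The first term of a branch chooses the set, the remaining terms are a branch of it. *)
Lemma suslin_bigcup (Q : set (set W)) (S : nat -> set W) :
  (forall i, suslin Q (S i)) -> suslin Q (\bigcup_i S i).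
Proof.
move=> /choice[C CP].
exists (fun k s => C (s 0%N) k (fun j => s j.+1)); split.
- move=> k s; have [+ _ _] := CP (s 0%N).
  move=> /(_ k (fun j => s j.+1))[N NP]; exists N.+1 => t ts.
  by rewrite ts//; apply: NP => i iN; exact: ts.
- by move=> k s; have [_ + _] := CP (s 0%N); exact.
- apply/seteqP; split => [x [i _]|x [s sP]].
    have [_ _ ->] := CP i => -[s sP].
    by exists (fun j => if j is j'.+1 then s j' else i).
  exists (s 0%N) => //; have [_ _ ->] := CP (s 0%N).
  by exists (fun j => s j.+1).
Qed.

(** One sequence carries a branch for every [i], with its [j]-th term stored at [pickle (i, j)]; the
    conditions are enumerated in the same way. *)
Lemma suslin_bigcap (Q : set (set W)) (S : nat -> set W) :
  (forall i, suslin Q (S i)) -> suslin Q (\bigcap_i S i).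
Proof.
move=> /choice[C CP].
pose row (s : nat -> nat) (i j : nat) := s (pickle (i, j)).
(* An [n] that codes no pair repeats a condition that is imposed anyway. *)
pose D (n : nat) (s : nat -> nat) :=
  if (unpickle n : option (nat * nat)) is Some (i, k) then C i k (row s i)
  else C 0%N 0%N (row s 0%N).
have Cloc i k s : exists N, forall t, (forall j, (j < N)%N -> t j = s j) ->
  C i k (row t i) = C i k (row s i).
  have [+ _ _] := CP i => /(_ k (row s i))[N NP].
  (* This sum exceeds every code [pickle (i, j)] with [j < N]. *)
  exists (\sum_(j < N) (pickle (i, nat_of_ord j)).+1)%N => t ts; apply: NP => j jN.
  by apply: ts; rewrite (bigD1 (Ordinal jN))//= addSn ltnS leq_addr.
exists D; split.
- by move=> n s; rewrite /D; case: (unpickle n) => [[i k]|]; exact: Cloc.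
- by move=> n s; rewrite /D; case: (unpickle n) => [[i k]|];
    [have [_ + _] := CP i|have [_ + _] := CP 0%N]; exact.
- apply/seteqP; split => [x Sx|x [s sP] i _].
    have /choice[s sP] : forall i, exists s, forall k, C i k s x.
      by move=> i; have := Sx i I; have [_ _ ->] := CP i.
    exists (fun n => if (unpickle n : option (nat * nat)) is Some (i, j)
      then s i j else 0%N) => n.
    rewrite /D; case: (unpickle n) => [[i k]|].
      rewrite (_ : row _ _ = s i) //.
      by apply/funext => j; rewrite /row pickleK.
    rewrite (_ : row _ _ = s 0%N) //.
    by apply/funext => j; rewrite /row pickleK.
  have [_ _ ->] := CP i; exists (row s i) => k.
  by have := sP (pickle (i, k)); rewrite /D pickleK.
Qed.

(** Analytic sets are not closed under complement; demanding both halves gives a class that is, and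
    so reaches the Borel sets. *)
Definition bisuslin (Q : set (set W)) (S : set W) :=
  suslin Q S /\ suslin Q (~` S).

Lemma bisuslinC (Q : set (set W)) S : bisuslin Q S -> bisuslin Q (~` S).
Proof. by move=> [? ?]; split => //; rewrite setCK. Qed.

Lemma bisuslin_bigcup (Q : set (set W)) (S : nat -> set W) :
  (forall i, bisuslin Q (S i)) -> bisuslin Q (\bigcup_i S i).
Proof.
move=> QS; split; first by apply: suslin_bigcup => i; exact: (QS i).1.
by rewrite setC_bigcup; apply: suslin_bigcap => i; exact: (QS i).2.
Qed.

End Suslin.

Lemma nested_compact_nonempty (W : topologicalType) (F : nat -> set W) :
  compact (F 0%N) -> (forall n, closed (F n)) ->
  (forall n, F n.+1 `<=` F n) -> (forall n, F n !=set0) ->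
  \bigcap_n F n !=set0.
Proof.
move=> cF0 clF Fdec Fne.
have Fle m n : (m <= n)%N -> F n `<=` F m.
  move=> /subnK <-; elim: (n - m)%N => // k ih.
  by rewrite addSn; apply: subset_trans ih; exact: Fdec.
have FF : ProperFilter (filter_from setT F).
  apply: filter_from_proper; last by move=> n _; exact: Fne.
  apply: filter_fromT_filter; first by exists 0%N.
  move=> i j; exists (maxn i j) => x Fx; split; apply: Fle Fx;
  by rewrite ?leq_maxl ?leq_maxr.
have [|x [_ xF]] := cF0 _ FF; first by exists 0%N.
exists x => n _; apply: clF => A nA.
by apply: xF nA; exists n.
Qed.

(* If the intersection of the analytic sets cannot be separated, then a
   coordinate of one of the branches can be fixed without making it separable;
   the branches obtained in the limit violate compactness. *)
Section NovikovSeparation.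
Context {W : topologicalType}.
(** The class of admissible separating sets depends on the index: the application leaves it free at
    [0] and demands a Borel dependence on the second coordinate elsewhere. *)
Variable V : nat -> set (set W).
Variable C : nat -> nat -> (nat -> nat) -> set W.
Hypothesis C_loc : forall n, locally_determined (C n).
Hypothesis C_closed : forall n k s, closed (C n k s).
Hypothesis C_compact : forall s, compact (C 0%N 0%N s).
Hypothesis C_V : forall n k s, V n (C n k s).
Hypothesis V_setT : forall n, V n setT.
Hypothesis V_bigcup : forall n f, (forall i, V n (f i)) -> V n (\bigcup_(i : nat) f i).
Hypothesis V_bigcap : forall n f, (forall i, V n (f i)) -> V n (\bigcap_(i : nat) f i).

(** All branches are interleaved in a single sequence [u], so that their coordinates are fixed one
    at a time, along prefixes of [u]. *)
Let code (n j : nat) : nat := pickle (n, j).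

Let branch n (u : nat -> nat) N := [set x | exists t : nat -> nat,
  (forall j, (code n j < N)%N -> t j = u (code n j)) /\ forall k, C n k t x].

Let separated u N := exists B : nat -> set W, [/\ forall n, V n (B n),
  forall n, branch n u N `<=` B n & \bigcap_n B n = set0].

Let upd (u : nat -> nat) N i := fun j => if j == N then i else u j.

(** Position [N] concerns one branch only. The set of index [n0] is the union over [i] of the parts
    whose branch has [i] there, and the other sets do not see [i]: take unions at [n0] and
    intersections elsewhere. *)
Let separated_step u N :
  (forall i, separated (upd u N i) N.+1) -> separated u N.
Proof.
move=> /choice[B BP].
(* If [N] codes nothing, no branch is affected and [0] serves as well. *)
pose n0 := if (unpickle N : option (nat * nat)) is Some (n, j) then n : nat else 0%N.
exists (fun n => if n == n0 then \bigcup_i B i n else \bigcap_i B i n); split.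
- move=> n; case: ifP => _; [apply: V_bigcup|apply: V_bigcap] => i;
  by have [+ _ _] := BP i; exact.
- move=> n x [t [tu tC]].
  case: ifPn => [/eqP nn0|nn0].
    pose i := if (unpickle N : option (nat * nat)) is Some (n, j) then t j else 0%N.
    exists i => //; have [_ + _] := BP i; apply; exists t; split => // j.
    rewrite ltnS leq_eqVlt => /orP[/eqP jN|jN].
      by rewrite /upd jN eqxx /i -jN /code pickleK.
    by rewrite /upd ltn_eqF// tu.
  move=> i _; have [_ + _] := BP i; apply; exists t; split => // j.
  rewrite ltnS leq_eqVlt => /orP[/eqP jN|jN].
    by move: nn0; rewrite /n0 -jN /code pickleK eqxx.
  by rewrite /upd ltn_eqF// tu.
- rewrite -subset0 => x xB.
  have := xB n0 I; rewrite eqxx => -[i _ ix].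
  have [_ _] := BP i; rewrite -subset0; apply => n _.
  by have := xB n I; case: eqP => [->//|_ /(_ i I)].
Qed.

Lemma novikov_separation : \bigcap_n suslin_op (C n) = set0 ->
  exists B : nat -> set W, [/\ forall n, V n (B n),
    forall n, suslin_op (C n) `<=` B n & \bigcap_n B n = set0].
Proof.
move=> C0.
suff [B [VB CB B0]] : separated (fun=> 0%N) 0%N.
  by exists B; split => // n x [t tC]; apply: CB; exists t.
apply: contrapT => nsep0.
have /choice[g gP] : forall p : (nat -> nat) * nat, exists i,
    ~ separated p.1 p.2 -> ~ separated (upd p.1 p.2 i) p.2.+1.
  move=> [u N] /=; apply: contrapT => /forallNP H.
  have /not_implyP[ns _] := H 0%N; apply: ns.
  by apply: separated_step => i; have /not_implyP[_ /contrapT] := H i.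
(* Coordinates are fixed one by one, each with a value that keeps the family inseparable. *)
pose w := fix w N := if N is N'.+1 then upd (w N') N' (g (w N', N'))
  else fun=> 0%N.
have nsepw N : ~ separated (w N) N.
  by elim: N => // N ih; exact: (gP (w N, N)).
pose u N := w N.+1 N.
have uw N j : (j < N)%N -> w N j = u j.
  elim: N => // N ih; rewrite ltnS leq_eqVlt => /orP[/eqP->//|jN].
  by rewrite /= /upd ltn_eqF// ih.
have nsepu N : ~ separated u N.
  apply: contra_not (nsepw N) => -[B [VB CB B0]]; exists B; split => // n x.
  move=> [t [tw tC]]; apply: CB; exists t; split => // j jN.
  by rewrite tw// uw.
pose un n j := u (code n j).
(* A point of every [F N] would lie in all the sets, against the hypothesis; as the [F N] are nested
   and compact, one of them is empty. *)
pose F N := [set x | forall n k, (n <= N)%N -> (k <= N)%N -> C n k (un n) x].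
have [N FN0] : exists N, F N = set0.
  apply: contrapT => /forallNP Fne.
  have [] : \bigcap_n F n !=set0; last first.
    move=> x Fx; have : set0 x by rewrite -C0 => n _; exists (un n) => k;
      apply: (Fx (maxn n k) I); rewrite ?leq_maxl ?leq_maxr.
    by [].
  have Fcl N : closed (F N).
    rewrite (_ : F N = \bigcap_n \bigcap_k
        if (n <= N)%N && (k <= N)%N then C n k (un n) else setT); last first.
      apply/seteqP; split => [x Fx n _ k _|x Fx n k nN kN].
        by case: ifP => // /andP[nN kN]; exact: Fx.
      by have := Fx n I k I; rewrite nN kN.
    apply: closed_bigI => n _; apply: closed_bigI => k _.
    by case: ifP => // _; exact: closedT.
  apply: nested_compact_nonempty => //.
  - have F0C : F 0%N `<=` C 0%N 0%N (un 0%N) by move=> x; apply.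
    exact: subclosed_compact (Fcl 0%N) (@C_compact (un 0%N)) F0C.
  - move=> N x Fx n k nN kN.
    by apply: Fx; rewrite ltnW.
  - by move=> N; apply/set0P/eqP; exact: Fne.
have /choice[L LP] : forall p : nat * nat, exists L, forall t,
    (forall j, (j < L)%N -> t j = un p.1 j) -> C p.1 p.2 t = C p.1 p.2 (un p.1).
  by move=> [n k]; exact: C_loc.
(* The finitely many sets defining [F N] read only coordinates with code below [M], so they separate
   the branches cut at [M], which [nsepu M] forbids. *)
pose M := (\sum_(n < N.+1) \sum_(k < N.+1)
  \sum_(j < L (nat_of_ord n, nat_of_ord k)) (code n j).+1)%N.
apply: (nsepu M).
(* Capping the index at [N] writes a finite intersection as a countable one, the form that
   [V_bigcap] accepts. *)
exists (fun n => if (n <= N)%N then \bigcap_k C n (minn k N) (un n) else setT).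
split.
- by move=> n; case: ifP => // _; exact: V_bigcap.
- move=> n x [t [tu tC]]; case: ifP => // nN k _.
  have kN : (minn k N < N.+1)%N by rewrite ltnS geq_minr.
  rewrite -ltnS in nN.
  rewrite -(LP (n, minn k N) t)//= => j jL; apply: tu.
  rewrite /M (bigD1 (Ordinal nN))//= (bigD1 (Ordinal kN))//=.
  by rewrite (bigD1 (Ordinal jL))//= !addSn ltnS -!addnA leq_addr.
- rewrite -FN0; apply/seteqP; split => [x xB n k nN kN|x Fx n _].
    by have := xB n I; rewrite nN => /(_ k I); rewrite (minn_idPl kN).
  by case: ifP => // nN k _; apply: Fx => //; rewrite geq_minr.
Qed.

End NovikovSeparation.

(** * Countable compact bases and the Borel structure of R^n *)

Section CompactBase.
Context {R : realType}.

(** Second countability and local compactness in one countable witness; it makes open and closed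
    sets of a product countable unions of compact sets. *)
Definition compact_base (T : topologicalType) (b c : nat -> set T) :=
  [/\ forall i, open (b i), forall i, compact (c i), forall i, b i `<=` c i &
      forall x U, open U -> U x -> exists2 i, b i x & c i `<=` U].

Let center n (p : 'rV[rat]_n) : 'rV[R]_n := map_mx ratr p.

Definition rat_ball n (i : nat) : set 'rV[R]_n :=
  if (unpickle i : option ('rV[rat]_n * nat)) is Some (p, k)
  then ball (center p) k.+1%:R^-1 else set0.

Definition rat_closed_ball n (i : nat) : set 'rV[R]_n :=
  if (unpickle i : option ('rV[rat]_n * nat)) is Some (p, k)
  then closed_ball (center p) k.+1%:R^-1 else set0.

Lemma rV_compact_base n : compact_base (@rat_ball n) (@rat_closed_ball n).
Proof.
pose q (p : 'rV[rat]_n) : 'rV[R]_n := center p.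
pose r (k : nat) : R := k.+1%:R^-1.
have r_gt0 k : 0 < r k by rewrite invr_gt0.
rewrite /rat_ball /rat_closed_ball.
split.
- by move=> i; case: unpickle => [[p k]|]; [exact: ball_open|exact: open0].
- move=> i; case: unpickle => [[p k]|]; last exact: compact0.
  apply: bounded_closed_compact; last exact: closed_ball_closed.
  exists (`|q p| + r k); split; first by rewrite num_real.
  move=> x qx y; rewrite closed_ballE// /closed_ball_/= => pky.
  rewrite (le_trans _ (ltW qx))//.
  rewrite -[y](subrK (q p)) (le_trans (ler_normD _ _))// addrC lerD2l.
  by rewrite distrC.
- move=> i; case: unpickle => [[p k]|//]; exact: subset_closure.
- move=> x U oU Ux; have : nbhs x U by exact: open_nbhs_nbhs.
  rewrite -nbhs_ballE => -[e /= e0 eU].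
  have [k ke] : exists k, 3 * r k < e.
    have [k _ /(_ k (leqnn k)) ke] :=
      near_infty_natSinv_lt (PosNum (divr_gt0 e0 (ltr0Sn R 2))).
    exists k; move: ke => /=; rewrite ltr_pdivlMr// mulrC; exact.
  have /choice[s sP] (i : 'I_n) : exists s : rat, ratr s \in `]x 0 i - r k, x 0 i + r k[.
    by apply: rat_in_itvoo; have := r_gt0 k; lra.
  have xp : ball (q (\row_i s i)) (r k) x.
    split => // a i; rewrite ord1 !mxE /ball/= ltr_distlC.
    by have := sP i; rewrite in_itv/= => /andP[? ?]; apply/andP; split; lra.
  exists (pickle (\row_i s i, k)); rewrite pickleK//=.
  apply: subset_trans eU => y.
  rewrite closed_ballE// /closed_ball_/= => qy.
  have xp' : `|q (\row_i s i) - x| < r k.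
    by move: xp; rewrite -[X in X -> _]/(ball (q (\row_i s i)) (r k) x) -ball_normE.
  rewrite -ball_normE /ball_/=.
  rewrite (le_lt_trans (ler_distD (q (\row_i s i)) x y))// distrC.
  by rewrite -/(r k) in qy; have := r_gt0 k; lra.
Qed.

(** Open sets are countable unions of rational balls, and a ball of the sup norm is a finite
    intersection of conditions on coordinates. *)
Lemma measurable_fun_rV d (T : measurableType d) n (f : T -> Borel_rV R n) :
  (forall i, measurable_fun setT (fun t => (f t : 'rV[R]_n) 0 i)) ->
  measurable_fun setT f.
Proof.
move=> mf; apply: (@measurability _ _ T (Borel_rV R n) setT f (@open 'rV[R]_n)) => //.
move=> _ [U oU <-]; rewrite setTI.
have [_ _ bc bP] := rV_compact_base n.
rewrite (_ : _ @^-1` _ = \bigcup_i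
    (if `[< rat_ball i `<=` U >] then f @^-1` (@rat_ball n i) else set0)).
  apply: bigcupT_measurable => i; case: ifP => _; last exact: measurable0.
  rewrite /rat_ball; case: unpickle => [[p k]|]; last first.
    by rewrite preimage_set0; exact: measurable0.
  rewrite (_ : _ @^-1` _ = \bigcap_(j in [set: 'I_n])
      ((fun t => (f t : 'rV[R]_n) 0 j) @^-1` ball (center p 0 j) k.+1%:R^-1)).
    apply: fin_bigcap_measurable => [|j _]; first exact: finite_finset.
    rewrite -[X in measurable X]setTI; apply: mf => //.
    by apply: open_measurable; exact: ball_open.
  apply/seteqP; split => [t [_ h] j _|t h]; first exact: h.
  by split; [rewrite invr_gt0|move=> a j; rewrite ord1; exact: h].
apply/seteqP; split => [t Ut|t [i _]]; last by case: ifPn => // /asboolP; apply.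
have [i it iU] := bP _ _ oU Ut; exists i => //; rewrite asboolT//.
exact: subset_trans (bc i) iU.
Qed.

End CompactBase.

(** * Projections of Borel sets with compact sections *)

Section CompactProjection.
Context {R : realType} {X Y : normedModType R}.
Variables (bX cX : nat -> set X) (bY cY : nat -> set Y).
Hypotheses (baseX : compact_base bX cX) (baseY : compact_base bY cY).

Let suslin_sigma_compact (O : set (X * Y)) (f : nat -> set (X * Y)) :
  (forall i, compact (f i)) -> O = \bigcup_i f i -> suslin compact O.
Proof. by move=> cf ->; apply: suslin_bigcup => i; exact: suslin_basic. Qed.

Let compactX_box i j : compact (cX i `*` cY j).
Proof.
by apply: compact_setX; [have [_ + _ _] := baseX|have [_ + _ _] := baseY]; exact.
Qed.

Let box_base (p : X * Y) O : open O -> O p -> exists i j,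
  [/\ bX i p.1, bY j p.2 & cX i `*` cY j `<=` O].
Proof.
move=> oO Op; have : nbhs p O by exact: open_nbhs_nbhs.
move=> [[A B]/= [nA nB] AB].
have [_ _ _ bXP] := baseX; have [_ _ _ bYP] := baseY.
have [i ip iA] := bXP p.1 A° (open_interior A) nA.
have [j jp jB] := bYP p.2 B° (open_interior B) nB.
exists i, j; split => // -[x y] [/= /iA Ax /jB By].
by apply: AB; split; exact: interior_subset.
Qed.

Lemma suslin_compact_open (O : set (X * Y)) : open O -> suslin compact O.
Proof.
move=> oO.
pose f n := if (unpickle n : option (nat * nat)) is Some (i, j) then
  (if `[< cX i `*` cY j `<=` O >] then cX i `*` cY j else set0) else set0.
apply: (@suslin_sigma_compact _ f).
  move=> n; rewrite /f; case: unpickle => [[i j]|]; last exact: compact0.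
  by case: ifP => _; [exact: compactX_box|exact: compact0].
apply/seteqP; split => [p Op|p [n _]].
  have [i [j [ip jp ijO]]] := box_base oO Op.
  exists (pickle (i, j)) => //; rewrite /f pickleK asboolT//.
  have [_ _ + _] := baseX => /(_ _ _ ip) ?; have [_ _ + _] := baseY => /(_ _ _ jp) ?.
  by [].
rewrite /f; case: unpickle => [[i j]|//]; case: ifPn => // /asboolP; exact.
Qed.

Lemma suslin_compact_closed (F : set (X * Y)) : closed F -> suslin compact F.
Proof.
move=> clF; pose f n := if (unpickle n : option (nat * nat)) is Some (i, j)
  then F `&` (cX i `*` cY j) else set0.
apply: (@suslin_sigma_compact _ f).
  move=> n; rewrite /f; case: unpickle => [[i j]|]; last exact: compact0.
  have FK : F `&` (cX i `*` cY j) `<=` cX i `*` cY j by move=> p [].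
  apply: subclosed_compact FK; last exact: compactX_box.
  apply: closedI => //; apply: compact_closed; last exact: compactX_box.
  exact: norm_hausdorff.
apply/seteqP; split => [p Fp|p [n _]].
  have [i [j [ip jp _]]] := box_base openT (I : setT p).
  exists (pickle (i, j)) => //; rewrite /f pickleK//; split => //.
  have [_ _ + _] := baseX => /(_ _ _ ip) ?; have [_ _ + _] := baseY => /(_ _ _ jp) ?.
  by [].
by rewrite /f; case: unpickle => [[i j] []|].
Qed.

Lemma bisuslin_open (O : set (X * Y)) : open O -> bisuslin compact O.
Proof.
move=> oO; split; first exact: suslin_compact_open.
by apply: suslin_compact_closed; exact: open_closedC.
Qed.

(** The class is a sigma-algebra that contains the open sets, and the generators of the product
    sigma-algebra are preimages of Borel sets under the continuous projections. *)
Lemma bisuslin_measurable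
  (S : set (g_sigma_algebraType (@open X) * g_sigma_algebraType (@open Y))) :
  measurable S -> bisuslin compact (S : set (X * Y)).
Proof.
have salg : sigma_algebra setT (bisuslin compact : set (set (X * Y))).
  split => [|A|A]; [exact: (bisuslin_open open0)| |exact: bisuslin_bigcup].
  by move=> bA; rewrite setTD; exact: bisuslinC.
have preim (T : ptopologicalType) (f : X * Y -> T)
    (B : set (g_sigma_algebraType (@open T))) :
    continuous f -> measurable B -> bisuslin compact (f @^-1` B).
  move=> cf; move: B; apply: smallest_sub; last first.
    by move=> B oB; apply: bisuslin_open; move/continuousP : cf; exact.
  split => [|A|A bA]; first by rewrite preimage_set0; case: salg.
    by rewrite setTD preimage_setC; exact: bisuslinC.
  by rewrite preimage_bigcup; exact: bisuslin_bigcup.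
move: S; apply: smallest_sub => // S [[A mA <-]|[B mB <-]]; rewrite setTI.
  by apply: (preim X) => // p; exact: cvg_fst.
by apply: (preim Y) => // p; exact: cvg_snd.
Qed.

(* Both [B] and its complement are analytic, and [y] lies outside the
   projection iff K is covered by finitely many basic open sets [bX n] whose
   product with [y] misses [B].  Novikov separation replaces the coanalytic
   condition "[bX n] x {y} misses B" by a Borel one. *)
Lemma measurable_compact_projection (K : set X)
  (B : set (g_sigma_algebraType (@open X) * g_sigma_algebraType (@open Y))) :
  compact K -> measurable B -> B `<=` K `*` setT ->
  (forall y, closed [set x : X | B (x, y)]) ->
  @measurable _ (g_sigma_algebraType (@open Y)) [set y | exists x, B (x, y)].
Proof.
move=> cK mB BK clB.
have clK : closed K by apply: compact_closed => //; exact: norm_hausdorff.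
have snd_cont (D : set (X * Y)) : {within D, continuous (@snd X Y)}.
  by apply: continuous_subspaceT => p; exact: cvg_snd.
have sndK (D : set (X * Y)) : compact D -> closed (snd @` D).
  move=> cD; apply: compact_closed; first exact: norm_hausdorff.
  exact: continuous_compact.
have clsnd (D : set Y) : closed D -> closed ((@snd X Y) @^-1` D).
  by move=> cD; apply: closed_comp => // p _; exact: cvg_snd.
have mBopen O : open O -> @measurable _ (g_sigma_algebraType (@open X)) O.
  by move=> oO; exact: sub_sigma_algebra.
have mYclosed F : closed F -> @measurable _ (g_sigma_algebraType (@open Y)) F.
  move=> cF; rewrite -(setCK (F : set (g_sigma_algebraType (@open Y)))).
  by apply: measurableC; apply: sub_sigma_algebra; exact: closed_openC.
have [bXo _ _ bXbase] := baseX.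
have mU n : measurable (B `&` (bX n `*` setT :
    set (g_sigma_algebraType (@open X) * g_sigma_algebraType (@open Y)))).
  by apply: measurableI => //; apply: measurableX => //; exact: mBopen.
have [D [Dloc Dcompact DE]] : suslin compact ((K `*` setT) `\` B : set (X * Y)).
  have /bisuslin_measurable[] // : measurable ((K `*` setT) `\` B :
      set (g_sigma_algebraType (@open X) * g_sigma_algebraType (@open Y))).
  apply: measurableD => //; apply: measurableX => //.
  rewrite -(setCK K); apply: measurableC; apply: mBopen.
  exact: closed_openC.
have /choice[c cP] : forall n, exists c, [/\ locally_determined c,
    forall k s, compact (c k s) & B `&` (bX n `*` setT) = suslin_op c].
  by move=> n; have [+ _] := bisuslin_measurable (mU n).
(* Intersecting the first [k + 1] sets makes the scheme decreasing; by compactness projecting it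
   then loses nothing, and [E n] is a scheme for the projection of [B] over [bX n]. *)
pose E n k s := snd @` (\bigcap_(j in [set j | (j <= k)%N]) c n j s).
have Eclosed n k s : closed (E n k s).
  apply: sndK; have [_ cc _] := cP n.
  have c0 : \bigcap_(j in [set j | (j <= k)%N]) c n j s `<=` c n 0%N s.
    by move=> p; exact.
  apply: subclosed_compact c0 => //; apply: closed_bigI => j _.
  by apply: compact_closed => //; exact: norm_hausdorff.
(* Scheme [0] describes the points of [K] x [Y] outside [B]. The set of index [n + 1] omits [(x, y)]
   exactly when [x] is in [bX n] and [bX n] x {y} misses [B]. *)
pose C n := if n is n'.+1 then fun k s =>
  (~` (bX n' `*` setT)) `|` snd @^-1` (E n' k s) else D.
pose V n : set (set (X * Y)) := if n is n'.+1 then [set S |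
  exists A, @measurable _ (g_sigma_algebraType (@open Y)) A /\
    S = (~` (bX n' `*` setT)) `|` snd @^-1` A] else setT.
have bXclosed n : closed (~` (bX n `*` setT) : set (X * Y)).
  rewrite (_ : ~` _ = fst @^-1` (~` bX n)).
    apply: closed_comp => [p _|]; first exact: cvg_fst.
    exact: open_closedC.
  by apply/seteqP; split => p /= nb b; apply: nb => //; case: b.
have [] := @novikov_separation (X * Y)%type V C.
- case => // n k s; have [cl _ _] := cP n.
  have /choice[L LP] : forall j, exists N, forall t,
    (forall i, (i < N)%N -> t i = s i) -> c n j t = c n j s by move=> j; exact: cl.
  exists (\sum_(j < k.+1) L j)%N => t ts /=; congr (_ `|` snd @^-1` (snd @` _)).
  apply: eq_bigcapr => j /= jk; apply: LP => i iL; apply: ts.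
  rewrite -ltnS in jk.
  by rewrite (bigD1 (Ordinal jk))//= (leq_trans iL)// leq_addr.
- case => [|n] k s /=; first by apply: compact_closed => //; exact: norm_hausdorff.
  by apply: closedU => //; exact: clsnd.
- by move=> s; exact: Dcompact.
- case => // n k s; exists (E n k s); split => //.
  exact: mYclosed.
- case => // n; exists setT; split => //; by rewrite preimage_setT setUT.
- case => // n f /choice[A AP]; exists (\bigcup_i A i); split.
    by apply: bigcupT_measurable => i; have [] := AP i.
  apply/seteqP; split => [p [i _]|p].
    have [_ ->] := AP i; move=> [?|?]; [by left|by right; exists i].
  move=> [bp|[i _ Ap]]; [exists 0%N|exists i] => //.
    by have [_ ->] := AP 0%N; left.
  by have [_ ->] := AP i; right.
- case => // n f /choice[A AP]; exists (\bigcap_i A i); split.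
    by apply: bigcapT_measurable => i; have [] := AP i.
  rewrite preimage_bigcap setU_bigcapr//; apply: eq_bigcapr => i _; by have [] := AP i.
(* Sections of [B] are closed, so a point [(x, y)] outside [B] has some [bX n] around [x] with
   [cX n] disjoint from the section; a common point of all the sets would put a point of [B]
   there. *)
- apply/seteqP; split => // -[x y] pC; exfalso.
  have [_ nBp] : ((K `*` setT) `\` B) (x, y) by rewrite DE; exact: (pC 0%N I).
  have [n bnp cnB] := bXbase x _ (closed_openC (clB y)) nBp.
  have [s sP] := pC n.+1 I.
  have Ep k : E n k s y by case: (sP k) => // -[].
  have [cloc ccompact cE] := cP n.
  have ccl k t : closed (c n k t) by apply: compact_closed => //; exact: norm_hausdorff.
  pose F k := (\bigcap_(j in [set j | (j <= k)%N]) c n j s) `&` snd @^-1` [set y].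
  have clF k : closed (F k).
    apply: closedI; first by apply: closed_bigI => j _; exact: ccl.
    by apply: clsnd; apply: compact_closed; [exact: norm_hausdorff|exact: compact_set1].
  have F0 : F 0%N `<=` c n 0%N s by move=> w [w0 _]; exact: w0.
  have [] := nested_compact_nonempty (subclosed_compact (clF 0%N)
    (@ccompact 0%N s) F0) clF.
  - move=> k w [wc wp]; split => // j /= jk.
    by apply: wc; rewrite /= (leq_trans jk).
  - by move=> k; have [w wc wp] := Ep k; exists w.
  - move=> w Fw; have [Bw [bw _]] : (B `&` (bX n `*` setT)) w.
      rewrite cE; exists s => k; by have [+ _] := Fw k I; apply => /=.
    have [_ wp] := Fw 0%N I.
    have [_ _ bc _] := baseX; apply: (cnB w.1 (bc _ _ bw)) => /=.
    by rewrite -[y]wp -surjective_pairing.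
move=> S [VS CS S0].
(* [A n] is Borel and contains the projection of [B] over [bX n], so [y] outside [A n] certifies
   that [bX n] x {y} misses [B]. *)
have /choice[A AP] n := VS n.+1.
have proj_sub n y : (exists x, B (x, y) /\ bX n x) -> A n y.
  move=> [x [Bxy bx]].
  have : S n.+1 (x, y).
    apply: CS; have [cloc ccompact cE] := cP n.
    have : (B `&` (bX n `*` setT)) (x, y) by [].
    rewrite cE => -[s sP]; exists s => k; right; exists (x, y) => // j _.
  by have [_ ->] := AP n; move=> [[]|].
rewrite -[X in measurable X]setCK; apply: measurableC.
(* By compactness of [K] finitely many certificates suffice, and there are only countably many
   finite sets of indices. *)
rewrite (_ : ~` _ = \bigcup_(s : {fset nat}) (if `[< K `<=` cover [set` s] bX >]
    then \bigcap_(n in [set` s]) ~` A n else set0)).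
  apply: countable_bigcupT_measurable; first exact: countableP.
  move=> s; case: ifP => _; last exact: measurable0.
  apply: fin_bigcap_measurable => [|n _]; first exact: finite_fset.
  by apply: measurableC; exact: (AP n).1.
apply/seteqP; split => [y nBy|y [s _]].
  have cov : K `<=` \bigcup_(n in [set n | ~ A n y]) bX n.
    move=> x Kx; apply: contrapT => nx.
    suff : (\bigcap_n S n) (x, y) by rewrite S0.
    move=> [_|n _].
      by apply: CS; rewrite -DE; split => // Bxy; apply: nBy; exists x.
    have [_ ->] := AP n; have [An|nAn] := pselect (A n y); first by right.
    by left => -[bx _]; apply: nx; exists n.
  move: cK; rewrite compact_cover => /(_ nat [set n | ~ A n y] bX).
  case=> // s sA Kcov; exists s => //; rewrite asboolT// => n ns.
  by have := sA n ns; rewrite inE.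
case: ifPn => // /asboolP Kcov yA [x Bxy].
have [n ns bx] := Kcov _ (BK _ Bxy).1.
by apply: (yA n ns); apply: proj_sub; exists x.
Qed.

End CompactProjection.

(** * Minimizing a lower semicontinuous function over a compact set *)

Lemma closed_lsc_sublevel (R : realType) (T : pseudoMetricType R) (K : set T)
  (f : T -> \bar R) (a : \bar R) : closed K -> lsc_on K f ->
  closed [set x | K x /\ (f x <= a)%E].
Proof.
move=> clK lf x xcl.
have Kx : K x by apply: clK; move: x xcl; apply: closure_subset => x [].
split => //; rewrite leNgt; apply/negP => /(lf x Kx)[e e0 eP].
have [y [[Ky ya] xy]] := xcl _ (nbhsx_ballx x e e0).
by have := eP y Ky xy; rewrite ltNge ya.
Qed.

(** The pairs with [f <= a] form a Borel set whose sections are closed in [K]; its projection is a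
    sublevel set of the minimum of [f] over [K]. *)
Lemma measurable_exists_lsc_le (R : realType) m n (K : set 'rV[R]_m)
  (f : 'rV[R]_m -> 'rV[R]_n -> R) (a : R) : compact K ->
  measurable_fun (K `*` setT : set (Borel_rV R m * Borel_rV R n))
    (fun p : Borel_rV R m * Borel_rV R n => f p.1 p.2) ->
  (forall y, lsc_on K (fun x => (f x y)%:E)) ->
  @measurable _ (Borel_rV R n) [set y | exists2 x, K x & f x y <= a].
Proof.
move=> cK mf lf.
have clK : closed K by apply: compact_closed => //; exact: norm_hausdorff.
have baseX := @rV_compact_base R m.
have baseY := @rV_compact_base R n.
have mK : @measurable _ (Borel_rV R m) K.
  rewrite -(setCK (K : set (Borel_rV R m))); apply: measurableC.
  by apply: sub_sigma_algebra; exact: closed_openC.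
have mKT : measurable (K `*` setT : set (Borel_rV R m * Borel_rV R n)).
  exact: measurableX.
have mB := mf mKT _ (measurable_itv `]-oo, a]).
rewrite (_ : mkset _ = [set y | exists x, ((K `*` setT) `&`
    (fun p : Borel_rV R m * Borel_rV R n => f p.1 p.2) @^-1` `]-oo, a]) (x, y)]).
  apply: (measurable_compact_projection baseX baseY cK mB) => [p [] //|y].
  rewrite [X in closed X](_ : _ = [set x | K x /\ ((f x y)%:E <= a%:E)%E]).
    exact: closed_lsc_sublevel.
  apply/seteqP; split => x /=.
    by move=> [[Kx _]]; rewrite in_itv/= => fa; rewrite lee_fin.
  by move=> [Kx]; rewrite lee_fin in_itv => fa.
apply/seteqP; split => y [x].
  by move=> Kx fa; exists x; split => //=; rewrite in_itv.
by move=> [[/= Kx _]]; rewrite in_itv/= => fa; exists x.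
Qed.
(** * Strong law of large numbers *)

Definition push_measure d d' (T : measurableType d) (U : measurableType d')
    (R : realFieldType) (m : {measure set T -> \bar R}) (f : T -> U)
    (mf : measurable_fun setT f) : {measure set U -> \bar R} :=
  measure_function_pushforward__canonical__measure_function_Measure m mf.

(** Moves an event into the measure: the integral then runs over the whole space, where pushforwards
    and uniqueness of measures apply. *)
Lemma ge0_integral_mrestr d (T : measurableType d) (R : realType)
    (m : {measure set T -> \bar R}) (D : set T) (mD : measurable D)
    (g : T -> \bar R) : measurable_fun setT g -> (forall t, 0 <= g t)%E ->
  (\int[m]_(t in D) g t = \int[mrestr m mD]_t g t)%E.
Proof.
move=> mg g0; transitivity (\int[mrestr m mD]_(t in D) g t)%E.
  by apply: eq_measure_integral => B mB BD; rewrite /= /mrestr setIidl.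
rewrite [RHS](ge0_negligible_integral _ (N := ~` D))//.
- by rewrite setTD setCK.
- exact: measurableC.
- by rewrite /= /mrestr setICl measure0.
Qed.

(** * The cylinder sigma-algebra on sequences *)

Section SequenceSpace.
Context {d : measure_display} {T : measurableType d}.

Definition cylinder : set (set (nat -> T)) := [set B |
  exists C : nat -> set T, [/\ forall i, measurable (C i),
    exists N, forall i, (N <= i)%N -> C i = setT &
    B = [set z | forall i, C i (z i)]]].

Definition seq_space := g_sigma_algebraType cylinder.

Lemma cylinder_setI_closed : setI_closed cylinder.
Proof.
move=> _ _ [C [mC [N CN] ->]] [C' [mC' [N' CN'] ->]].
exists (fun i => C i `&` C' i); split.
- by move=> i; exact: measurableI.
- exists (maxn N N') => i; rewrite geq_max => /andP[Ni N'i].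
  by rewrite CN// CN'// setIT.
- by apply/seteqP; split => [z [h h'] i|z h]; split => // i; have [] := h i.
Qed.

Lemma cylinder_setT : cylinder setT.
Proof.
exists (fun=> setT); split; [by []|by exists 0%N|].
by apply/seteqP; split.
Qed.

Lemma cylinder_coord i (D : set T) : measurable D ->
  cylinder [set z | D (z i)].
Proof.
move=> mD; exists (fun j => if j == i then D else setT); split.
- by move=> j; case: ifP.
- exists i.+1 => j ij; rewrite ifF//; apply/negbTE.
  by rewrite neq_ltn orbC ij.
- by apply/seteqP; split => [z Dz j|z h]; [case: eqP => // ->|have := h i;
  rewrite eqxx].
Qed.

Lemma measurable_coord i : measurable_fun setT (fun z : seq_space => z i).
Proof.
move=> _ D mD; rewrite setTI; apply: sub_sigma_algebra.
exact: cylinder_coord.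
Qed.

Lemma measurable_to_seq_space d' (U : measurableType d') (f : U -> seq_space) :
  (forall i, measurable_fun setT (fun u => f u i)) -> measurable_fun setT f.
Proof.
move=> mf; apply: (@measurability _ _ U seq_space setT f cylinder) => //.
move=> _ [_ [C [mC _ ->]] <-]; rewrite setTI.
rewrite (_ : _ @^-1` _ = \bigcap_i ((fun u => f u i) @^-1` C i)); last first.
  by apply/seteqP; split => [u h i _|u h i]; [exact: h|exact: (h i I)].
apply: bigcapT_measurable => i; rewrite -[X in measurable X]setTI.
exact: mf.
Qed.

End SequenceSpace.

(** * Independent sequences, the shift and negative drift *)

Section IidSequence.
Context {R : realType} {dO : measure_display} {Omega : measurableType dO}.
Context {d : measure_display} {T : measurableType d}.
Variables (P : probability Omega R) (Z : nat -> Omega -> T).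
Variable PZ : probability T R.
Hypothesis mZ : forall i, measurable_fun setT (Z i).
Hypothesis indepZ : mutually_independent P Z.
Hypothesis lawZ : forall i (B : set T), measurable B -> P (Z i @^-1` B) = PZ B.

Let traj w : seq_space := fun i => Z i w.
Let shifted_traj w : seq_space := fun i => Z i.+1 w.

Let mtraj : measurable_fun setT traj.
Proof. exact: measurable_to_seq_space. Qed.

Let mshifted_traj : measurable_fun setT shifted_traj.
Proof. by apply: measurable_to_seq_space => i; exact: mZ. Qed.

Let P_cylinder (C : nat -> set T) N : (forall i, measurable (C i)) ->
  (forall i, (N <= i)%N -> C i = setT) ->
  P [set w | forall i, C i (Z i w)] = (\prod_(i < N) PZ (C i))%E.
Proof.
move=> mC CN; pose J : {fset nat} := [fset i in iota 0 N]%fset.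
have iJ i : (i \in J) = (i < N)%N by rewrite inE/= mem_iota add0n.
have -> : [set w | forall i, C i (Z i w)] = \bigcap_(j in [set` J]) (Z j @^-1` C j).
  apply/seteqP; split => [w h i _|w h i]; first exact: h.
  case: (ltnP i N) => [iN|/CN->//].
  by apply: h; rewrite /= iJ.
rewrite indepZ => [|j _]; last exact: mC.
under eq_bigr do rewrite lawZ//.
rewrite (perm_big (iota 0 N)) /=;
  first by rewrite -(big_mkord xpredT (fun i => PZ (C i))) /index_iota subn0.
by apply: uniq_perm; [exact: fset_uniq|exact: iota_uniq|move=> i;
  rewrite iJ mem_iota add0n].
Qed.

(** Both sides are finite measures in [E], so cylinders suffice; there, [D] put in front of a
    cylinder gives a longer cylinder. The case [D = setT] is stationarity. *)
Let head_indep_tail (D : set T) (E : set seq_space) : measurable D ->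
  measurable E ->
  P (Z 0%N @^-1` D `&` shifted_traj @^-1` E) = (PZ D * P (traj @^-1` E))%E.
Proof.
move=> mD mE.
have mZD : measurable (Z 0%N @^-1` D) by rewrite -[X in measurable X]setTI; exact: mZ.
have PD0 : 0 <= fine (PZ D) by rewrite fine_ge0.
pose m1 := push_measure (mrestr P mZD) mshifted_traj.
pose m2 := mscale (NngNum PD0) (push_measure P mtraj).
have <- : m1 E = P (Z 0%N @^-1` D `&` shifted_traj @^-1` E).
  by rewrite /m1/= /pushforward /mrestr setIC.
have <- : m2 E = (PZ D * P (traj @^-1` E))%E.
  by rewrite /m2 /mscale/= fineK// fin_num_measure.
apply: (@measure_unique _ R seq_space cylinder (fun=> setT)) => //.
- exact: cylinder_setI_closed.
- by move=> _; exact: cylinder_setT.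
- by rewrite bigcup_const//; exists 0%N.
- move=> _ [C [mC [N CN] ->]].
  rewrite /m1 /m2/= /pushforward /mrestr /mscale /= fineK ?fin_num_measure//.
  have -> : pushforward P traj [set z | forall i, C i (z i)] =
      (\prod_(i < N) PZ (C i))%E := P_cylinder mC CN.
  pose C' i := if i is i'.+1 then C i' else D.
  rewrite [X in P X](_ : _ = [set w | forall i, C' i (Z i w)]); last first.
    apply/seteqP; split => [w [h D0] [|i]//|w h].
    by split => [i|]; [exact: (h i.+1)|exact: (h 0%N)].
  rewrite (@P_cylinder C' N.+1); [|by case|by case=> // i; exact: CN].
  by rewrite big_ord_recl.
- move=> _; apply: (@le_lt_trans _ _ 1%E); last exact: ltry.
  rewrite /m1/= /pushforward /mrestr preimage_setT setTI.
  exact: probability_le1.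
Qed.

Let mshifted_preimage E : measurable E -> measurable (shifted_traj @^-1` E).
Proof. by move=> mE; rewrite -[X in measurable X]setTI; exact: mshifted_traj. Qed.

Let mtraj_preimage E : measurable E -> measurable (traj @^-1` E).
Proof. by move=> mE; rewrite -[X in measurable X]setTI; exact: mtraj. Qed.

Let law_shift E : measurable E -> P (shifted_traj @^-1` E) = P (traj @^-1` E).
Proof.
move=> mE; have := head_indep_tail measurableT mE.
by rewrite preimage_setT setTI probability_setT mul1e.
Qed.

Let ge0_integral_shift E (g : seq_space -> \bar R) : measurable E ->
  measurable_fun setT g -> (forall z, 0 <= g z)%E ->
  (\int[P]_(w in shifted_traj @^-1` E) g (shifted_traj w) =
   \int[P]_(w in traj @^-1` E) g (traj w))%E.
Proof.
move=> mE mg g0; have mgE : measurable_fun E g by exact: measurable_funTS.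
transitivity (\int[push_measure P mshifted_traj]_(z in E) g z)%E.
  by rewrite ge0_integral_pushforward.
transitivity (\int[push_measure P mtraj]_(z in E) g z)%E.
  by apply: eq_measure_integral => A mA _; exact: law_shift.
by rewrite ge0_integral_pushforward.
Qed.

Let ge0_integral_head E (g : T -> \bar R) : measurable E ->
  measurable_fun setT g -> (forall z, 0 <= g z)%E ->
  (\int[P]_(w in shifted_traj @^-1` E) g (Z 0%N w) =
   P (traj @^-1` E) * \int[PZ]_t g t)%E.
Proof.
move=> mE mg g0; set A := shifted_traj @^-1` E.
have mA : measurable A by exact: mshifted_preimage.
have mgZ : measurable_fun setT (fun w => g (Z 0%N w)) by exact: measurableT_comp.
have pE0 : 0 <= fine (P (traj @^-1` E)) by rewrite fine_ge0.
transitivity (\int[mrestr P mA]_w g (Z 0%N w))%E.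
  exact: ge0_integral_mrestr.
transitivity (\int[push_measure (mrestr P mA) (mZ 0%N)]_t g t)%E.
  by rewrite ge0_integral_pushforward.
transitivity (\int[mscale (NngNum pE0) PZ]_t g t)%E.
  apply: eq_measure_integral => B mB _.
  rewrite /= /pushforward /mrestr /mscale/= fineK; last first.
    by rewrite fin_num_measure//; exact: mtraj_preimage.
  by rewrite muleC; exact: head_indep_tail.
rewrite ge0_integral_mscale//= fineK// fin_num_measure//; exact: mtraj_preimage.
Qed.

Variable f : T -> R.
Hypothesis intf : PZ.-integrable setT (EFin \o f).

Let mf : measurable_fun setT f.
Proof. by apply/measurable_EFinP; exact: measurable_int intf. Qed.

Lemma iid_integrable_comp i : P.-integrable setT (EFin \o (f \o Z i)).
Proof.
have mfZ : measurable_fun setT (f \o Z i) by exact: measurableT_comp.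
apply/integrableP; split; first exact/measurable_EFinP.
have /integrableP[_] := intf; apply: le_lt_trans.
rewrite le_eqVlt; apply/orP; left; apply/eqP.
transitivity (\int[push_measure P (mZ i)]_t `|(EFin \o f) t|)%E.
  rewrite ge0_integral_pushforward//; apply: measurableT_comp => //.
  exact/measurable_EFinP.
by apply: eq_measure_integral => B mB _; exact: lawZ.
Qed.

Let walk n (z : seq_space (T := T)) : R := \sum_(i < n) f (z i).

(** The maximum of [0] and the first [n] partial sums, written through the shift because Garsia's
    argument compares it with its own shift. *)
Let maxwalk := fix m n (z : seq_space (T := T)) : R :=
  if n is n'.+1 then Num.max 0 (f (z 0%N) + m n' (fun i => z i.+1)) else 0.

Let walkS n z : walk n.+1 z = f (z 0%N) + walk n (fun i => z i.+1).
Proof. by rewrite /walk big_ord_recl. Qed.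

Let mfcoord i : measurable_fun setT (fun z : seq_space => f (z i)).
Proof. by apply: (measurableT_comp mf); exact: measurable_coord. Qed.

Let mwalk n : measurable_fun setT (walk n).
Proof. by apply: measurable_sum => i; exact: mfcoord. Qed.

Let mmaxwalk n : measurable_fun setT (maxwalk n).
Proof.
elim: n => [|n ih] /=; first exact: measurable_cst.
apply: measurable_maxr; first exact: measurable_cst.
apply: measurable_funD; first exact: mfcoord.
apply: (measurableT_comp ih); apply: measurable_to_seq_space => i.
exact: measurable_coord.
Qed.

Let maxwalk_ge0 n z : 0 <= maxwalk n z.
Proof. by case: n => [|n]//=; rewrite le_max lexx. Qed.

Let le_maxwalkS n z : maxwalk n z <= maxwalk n.+1 z.
Proof.
elim: n z => [|n ih] z; first exact: maxwalk_ge0.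
rewrite [leLHS]/= [leRHS]/=; apply: le_max2 => //.
by rewrite lerD2l; exact: ih.
Qed.

Let le_maxwalk n n' z : (n <= n')%N -> maxwalk n z <= maxwalk n' z.
Proof.
move=> /subnK <-; elim: (n' - n)%N => // k ih.
by rewrite addSn (le_trans ih)// le_maxwalkS.
Qed.

Let walk_le_maxwalk n z : walk n z <= maxwalk n z.
Proof.
elim: n z => [|n ih] z; first by rewrite /walk big_ord0.
by rewrite walkS /= le_max lerD2l ih orbT.
Qed.

Let maxwalk_le_sum n z : maxwalk n z <= \sum_(i < n) `|f (z i)|.
Proof.
elim: n z => [|n ih] z /=; first by rewrite big_ord0.
by rewrite ge_max sumr_ge0//= big_ord_recl lerD ?ler_norm// ih.
Qed.

Let unbounded : set (seq_space (T := T)) :=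
  [set z | forall M : nat, exists n, M%:R < walk n z].

Let munbounded : measurable unbounded.
Proof.
rewrite (_ : unbounded = \bigcap_M \bigcup_n (walk n @^-1` `]M%:R, +oo[)).
  apply: bigcapT_measurable => M; apply: bigcupT_measurable => n.
  by rewrite -[X in measurable X]setTI; exact: mwalk.
apply/seteqP; split => [z h M _|z h M].
  by have [n nM] := h M; exists n => //=; rewrite in_itv/= andbT.
by have [n _ /=] := h M I; rewrite in_itv/= andbT; exists n.
Qed.

(** Dropping the first step changes all partial sums by the same finite amount. *)
Let unbounded_shift : shifted_traj @^-1` unbounded = traj @^-1` unbounded.
Proof.
have natlt (x : R) : exists M : nat, x <= M%:R.
  by exists (Num.bound `|x|); rewrite (le_trans (ler_norm x))// ltW// archi_boundP.
apply/seteqP; split => w /= h M.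
  have [M' M'P] := natlt (M%:R - f (Z 0%N w)).
  have [n nM'] := h M'; exists n.+1.
  by rewrite walkS -ltrBlDl (le_lt_trans M'P).
(* The maximum with [0] excludes [n = 0], where there is no step to drop. *)
have [M' M'P] := natlt (Num.max 0 (M%:R + f (Z 0%N w))).
have [[|n] nM'] := h M'.
  by move: nM'; rewrite /walk big_ord0 ltNge ler0n.
exists n; move: nM'; rewrite walkS => nM'.
have : f (traj w 0%N) = f (Z 0%N w) by [].
move: M'P; rewrite ge_max => /andP[_ M'P] fE.
rewrite fE in nM'; rewrite -[ltRHS](addKr (f (Z 0%N w))) addrC.
by rewrite ltrBrDr (le_lt_trans M'P).
Qed.

(** The offset [k] covers both the path and its shift. *)
Let maxwalk_integrable n (Y : Omega -> seq_space (T := T)) k D :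
  measurable D -> measurable_fun setT Y -> (forall w i, Y w i = Z (k + i)%N w) ->
  P.-integrable D (EFin \o (maxwalk n \o Y)).
Proof.
move=> mD mY YE; apply: (integrableS measurableT) => //.
apply: (@le_integrable _ _ _ P _ measurableT _
    (fun w => \sum_(i < n) (`|f (Z (k + i)%N w)|)%:E)%E).
- by apply/measurable_EFinP; exact: measurableT_comp.
- move=> w _; rewrite sumEFin !abse_EFin lee_fin.
  rewrite ger0_norm ?maxwalk_ge0// ger0_norm ?sumr_ge0//.
  rewrite (le_trans (maxwalk_le_sum _ _))//.
  by under eq_bigr do rewrite YE.
- apply: integrable_sum => // i _.
  exact: (@integrable_norm _ _ _ P setT (f \o Z (k + i)%N) (iid_integrable_comp _)).
Qed.

(* Garsia's argument: on the invariant set [unbounded], the increment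
   [maxwalk n.+1 - maxwalk n \o shift] has nonnegative mean and decreases
   to the first step [f (Z 0)], which is independent of that set. *)
Let unbounded_null : (\int[PZ]_t (f t)%:E < 0)%E -> P (traj @^-1` unbounded) = 0%E.
Proof.
move=> fneg; set A := traj @^-1` unbounded.
have mA : measurable A by exact: mtraj_preimage.
have mfZ : measurable_fun A (fun w => (f (Z 0%N w))%:E).
  by apply: measurable_funTS; apply/measurable_EFinP; exact: measurableT_comp.
have headE : (\int[P]_(w in A) (f (Z 0%N w))%:E = P A * \int[PZ]_t (f t)%:E)%E.
  have mfE : measurable_fun setT (EFin \o f) by exact/measurable_EFinP.
  rewrite integralE [in RHS]integralE muleBr ?fin_num_measure//; last first.
    by rewrite fin_num_adde_defl// fin_numN integrable_neg_fin_num.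
  have := ge0_integral_head munbounded (measurable_funepos mfE) (fun t =>
    funepos_ge0 _ t).
  have := ge0_integral_head munbounded (measurable_funeneg mfE) (fun t =>
    funeneg_ge0 _ t).
  by rewrite unbounded_shift -/A => <- <-; congr (_ - _)%E;
    apply: eq_integral => w _; rewrite ?funeposE ?funenegE.
pose g n w := maxwalk n.+1 (traj w) - maxwalk n (shifted_traj w).
have intg1 n : P.-integrable A (EFin \o (maxwalk n \o traj)).
  exact: (@maxwalk_integrable n traj 0%N).
have intg2 n : P.-integrable A (EFin \o (maxwalk n \o shifted_traj)).
  exact: (@maxwalk_integrable n shifted_traj 1%N).
(* As [A] is invariant, stationarity removes the shift from the second integral, and [maxwalk]
   increases with [n]. *)
have g_ge0 n : (0 <= \int[P]_(w in A) (g n w)%:E)%E.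
  have -> : (\int[P]_(w in A) (g n w)%:E = \int[P]_(w in A) (maxwalk n.+1 (traj w))%:E
      - \int[P]_(w in A) (maxwalk n (shifted_traj w))%:E)%E.
    exact: (integralB_EFin mA (intg1 n.+1) (intg2 n)).
  rewrite sube_ge0; last first.
    by apply/orP; left; exact: integrable_fin_num (intg2 n).
  have mm : measurable_fun setT (EFin \o maxwalk n).
    by apply/measurable_EFinP; exact: mmaxwalk.
  have -> : (\int[P]_(w in A) (maxwalk n (shifted_traj w))%:E =
      \int[P]_(w in A) (maxwalk n (traj w))%:E)%E.
    have := ge0_integral_shift munbounded mm (maxwalk_ge0 n).
    by rewrite unbounded_shift.
  apply: ge0_le_integral => //.
  - by move=> w _; rewrite lee_fin.
  - by apply/measurable_EFinP; apply: measurable_funTS;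
    exact: (measurableT_comp (mmaxwalk _)).
  - by apply/measurable_EFinP; apply: measurable_funTS;
    exact: (measurableT_comp (mmaxwalk _)).
  - by move=> w _; rewrite lee_fin le_maxwalkS.
have gE n w : g n w = Num.max (- maxwalk n (shifted_traj w)) (f (Z 0%N w)).
  by rewrite /g /= addr_maxl add0r addrK.
have mg n : measurable_fun A (fun w => (g n w)%:E).
  apply: measurable_funTS; apply/measurable_EFinP.
  by apply: measurable_funB; exact: measurableT_comp.
(* On [A] the maxima of the shifted path grow beyond all bounds, so the maximum in [gE] is
   eventually its second term. *)
have g_cvg w : A w -> (g n w)%:E @[n --> \oo] --> (f (Z 0%N w))%:E.
  rewrite /A -unbounded_shift => Aw.
  apply: cvg_near_cst.
  have [n nP] := Aw (Num.bound `|f (Z 0%N w)|).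
  exists n => // n' /= nn'; congr EFin; rewrite gE; apply/max_idPr.
  rewrite lerNl (le_trans _ (le_maxwalk _ nn'))// (le_trans _ (walk_le_maxwalk _ _))//.
  rewrite (le_trans _ (ltW nP))// (le_trans (ler_norm _))// normrN ltW//.
  by rewrite archi_boundP.
have [] := @dominated_convergence _ _ _ P A mA (fun n w => (g n w)%:E)
  (fun w => (f (Z 0%N w))%:E) (fun w => `|f (Z 0%N w)|%:E) mg mfZ.
- by apply: aeW => w Aw; exact: g_cvg.
- apply: (integrableS measurableT) => //.
  exact: (@integrable_norm _ _ _ P setT (f \o Z 0%N) (iid_integrable_comp _)).
- apply: aeW => w n Aw; rewrite abse_EFin lee_fin gE.
  have := maxwalk_ge0 n (shifted_traj w).
  case: (leP (- maxwalk n (shifted_traj w)) (f (Z 0%N w))) => [_ _|h h0]; first by [].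
  rewrite normrN ger0_norm// ler0_norm; first by rewrite lerNr ltW.
  by rewrite ltW// (lt_le_trans h)// oppr_le0.
move=> _ _ cvgI.
have : (0 <= \int[P]_(w in A) (f (Z 0%N w))%:E)%E.
  rewrite -(cvg_lim _ cvgI)//; apply: lime_ge; first by apply/cvg_ex;
    exists (\int[P]_(w in A) (f (Z 0%N w))%:E)%E.
  by apply: nearW => n; exact: g_ge0.
rewrite headE => PAf; apply/eqP; rewrite eq_le measure_ge0 andbT leNgt.
apply/negP => PA0; move: PAf; apply/negP; rewrite -ltNge.
by rewrite mule_gt0_lt0.
Qed.

Lemma iid_sum_bounded_above : (\int[PZ]_t (f t)%:E < 0)%E ->
  {ae P, forall w, exists M : nat, forall n, \sum_(i < n) f (Z i w) <= M%:R}.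
Proof.
move=> /unbounded_null P0; exists (traj @^-1` unbounded); split => //.
  exact: mtraj_preimage.
move=> w /= nM M; apply: contrapT => /forallNP nW; apply: nM; exists M => n.
by rewrite leNgt; apply/negP; exact: nW.
Qed.

End IidSequence.

(** * One-sided strong laws *)

Section StrongLaw.
Context {R : realType} {dO : measure_display} {Omega : measurableType dO}.
Context {d : measure_display} {T : measurableType d}.
Variables (P : probability Omega R) (Z : nat -> Omega -> T).
Variable PZ : probability T R.
Hypothesis mZ : forall i, measurable_fun setT (Z i).
Hypothesis indepZ : mutually_independent P Z.
Hypothesis lawZ : forall i (B : set T), measurable B -> P (Z i @^-1` B) = PZ B.

(** Centred at a level [b] strictly between the mean and [a], the sums have negative drift and stay
    below some [M]; the averages are then at most [b + M / n]. *)
Lemma strong_law_lt (f : T -> R) (a : R) : PZ.-integrable setT (EFin \o f) ->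
  (\int[PZ]_t (f t)%:E < a%:E)%E ->
  {ae P, forall w, \forall n \near \oo, n%:R^-1 * \sum_(i < n) f (Z i w) < a}.
Proof.
move=> intf.
have [I fI] : exists I, (\int[PZ]_t (f t)%:E = I%:E)%E.
  by exists (fine (\int[PZ]_t (f t)%:E)); rewrite fineK//;
    exact: integrable_fin_num intf.
rewrite fI lte_fin => Ia; pose b := (I + a) / 2.
have intb : PZ.-integrable setT (EFin \o (fun=> b)).
  exact: (finite_measure_integrable_cst PZ b).
have intfb : PZ.-integrable setT (EFin \o (fun t => f t - b)).
  exact: (integrableB measurableT intf intb).
have fb0 : (\int[PZ]_t (f t - b)%:E < 0)%E.
  have -> : (\int[PZ]_t (f t - b)%:E = \int[PZ]_t (f t)%:E - \int[PZ]_t b%:E)%E.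
    exact: (integralB_EFin measurableT intf intb).
  rewrite fI integral_cst//= probability_setT mule1.
  by rewrite -EFinB lte_fin /b; lra.
have := iid_sum_bounded_above mZ indepZ lawZ intfb fb0.
apply: filterS => w [M MP].
have ab : 0 < a - b by rewrite /b; lra.
exists (Num.bound `|M%:R / (a - b)|).+1 => // n /= Mn.
have n0 : (0 < n%:R :> R) by rewrite ltr0n (leq_trans _ Mn).
rewrite mulrC ltr_pdivrMr//.
have := MP n; rewrite sumrB sumr_const card_ord -mulr_natr => Mb.
suff : M%:R < (a - b) * n%:R by move: Mb; lra.
rewrite mulrC -ltr_pdivrMr// (le_lt_trans (ler_norm _))//.
rewrite (lt_le_trans (archi_boundP _))// ler_nat ltnW//.
Qed.

Lemma strong_law_gt (f : T -> R) (a : R) : PZ.-integrable setT (EFin \o f) ->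
  (a%:E < \int[PZ]_t (f t)%:E)%E ->
  {ae P, forall w, \forall n \near \oo, a < n%:R^-1 * \sum_(i < n) f (Z i w)}.
Proof.
move=> intf fa.
have intNf : PZ.-integrable setT (EFin \o (fun t => - f t)).
  exact: (integrableN intf).
have Nfa : (\int[PZ]_t (- f t)%:E < (- a)%:E)%E.
  have -> : (\int[PZ]_t (- f t)%:E = - \int[PZ]_t (f t)%:E)%E.
    rewrite -(integralN (f := EFin \o f))//.
    by rewrite fin_num_adde_defl// fin_numN integrable_neg_fin_num.
  by rewrite EFinN lteN2.
have := strong_law_lt intNf Nfa; apply: filterS => w; apply: filterS => n.
by rewrite sumrN mulrN ltrN2.
Qed.

End StrongLaw.
(** * Quantile transform *)

Section QuantileTransform.
Context {R : realType} {d : measure_display} {T : measurableType d}.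
Variables (P : probability T R) (X : {mfun T >-> R}).

Let F := distr_fun P X.

Let FE t : (F t)%:E = cdf (X : {RV P >-> R}) t.
Proof. by rewrite /F /distr_fun fineK//; apply: fin_num_measure;
  exact: measurable_funPTI. Qed.

Let F_nd s t : s <= t -> F s <= F t.
Proof. by move=> st; rewrite -lee_fin !FE; exact: cdf_nondecreasing. Qed.

(** Galois connection. The limits of the distribution function make the defining set nonempty and
    bounded below, and right continuity puts its infimum in it. *)
Lemma quantile_le u t : 0 < u < 1 -> (quantile F u <= t) = (u <= F t).
Proof.
move=> /andP[u0 u1]; set S := [set t | u <= F t].
have S0 : S !=set0.
  have /(_ [set y | (u%:E < y)%E]) := @cvg_cdfy1 _ _ _ P X.
  have nu : nbhs (1 : \bar R)%E [set y | (u%:E < y)%E].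
    by apply: open_nbhs_nbhs; split; [exact: open_ereal_gt_ereal|rewrite /= lte_fin].
  move=> /(_ nu) [r [rreal rP]].
  exists (r + 1); rewrite /S/=.
  have := rP (r + 1); rewrite /= ltrDl ltr01 => /(_ isT).
  by rewrite -FE lte_fin => /ltW.
have [r0 r0P] : exists r0, F r0 < u.
  have /(_ [set y | (y < u%:E)%E]) := @cvg_cdfNy0 _ _ _ P X.
  have nu : nbhs (0 : \bar R)%E [set y | (y < u%:E)%E].
    by apply: open_nbhs_nbhs; split; [exact: open_ereal_lt_ereal|rewrite /= lte_fin].
  move=> /(_ nu) [r [rreal rP]].
  exists (r - 1).
  have := rP (r - 1); rewrite /= gtrDl ltrN10 => /(_ isT).
  by rewrite -FE lte_fin.
have hS : has_inf S.
  split => //; exists r0 => s /= ut; rewrite leNgt; apply/negP => /ltW /F_nd.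
  by rewrite leNgt (lt_le_trans r0P).
have Sinf : u <= F (quantile F u).
  rewrite leNgt; apply/negP => Fu.
  have := @cdf_right_continuous _ _ _ P X (quantile F u).
  move=> /(_ [set y | (y < u%:E)%E]).
  have nu : nbhs (cdf (X : {RV P >-> R}) (quantile F u)) [set y | (y < u%:E)%E].
    by apply: open_nbhs_nbhs; split;
      [exact: open_ereal_lt_ereal|rewrite /= -FE lte_fin].
  move=> /(_ nu) [e /= e0 eP].
  have [s St tlt] := inf_adherent e0 hS.
  have : quantile F u <= s by apply: ge_inf => //; exact: hS.2.
  rewrite le_eqVlt => /orP[/eqP qt|qt].
    by move: St; rewrite /S/= -qt leNgt Fu.
  have := eP s; rewrite /= ltr0_norm ?subr_lt0// opprB ltrBlDl => /(_ tlt qt).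
  by rewrite -FE lte_fin ltNge => /negP; exact.
apply/idP/idP => [/F_nd|ut]; first exact: le_trans.
by apply: ge_inf => //; exact: hS.2.
Qed.

Let D : set R := `]0, 1[%classic.

(** A pushforward needs a function measurable on the whole line, while [quantile_le] speaks of [D]
    only; hence the extension by a constant. *)
Let q : R -> R := quantile F \_ D.

Let mD : measurable D. Proof. exact: measurable_itv. Qed.

Let q_ray t : D `&` q @^-1` `]t, +oo[ = D `&` `]F t, +oo[.
Proof.
apply/seteqP; split => u /= [Du]; rewrite !in_itv/= !andbT /q patchE mem_set//;
  by rewrite !ltNge quantile_le//; move: Du; rewrite /D/= in_itv.
Qed.

Let mq : measurable_fun setT q.
Proof.
apply/(measurable_restrictT _ mD).
apply: (measurability _ (RGenOInfty.measurableE R)) => _ [_ [t ->] <-].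
suff -> : D `&` quantile F @^-1` `]t, +oo[ = D `&` `]F t, +oo[.
  exact: measurableI.
rewrite -q_ray; apply/seteqP; split => u [Du] /=;
  by rewrite /q patchE mem_set.
Qed.

(** Open right rays generate the Borel sets; by [q_ray] such a ray pulls back to the interval from
    [F t] to [1], of length [1 - F t]. *)
Let quantile_law (A : set R) : measurable A ->
  push_measure (mrestr (@lebesgue_measure R) mD) mq A =
  push_measure P (measurable_funP X) A.
Proof.
have rayE t : push_measure (mrestr (@lebesgue_measure R) mD) mq `]t, +oo[%classic =
    push_measure P (measurable_funP X) `]t, +oo[%classic.
  rewrite /= /pushforward /mrestr setIC q_ray.
  have F01 : 0 <= F t <= 1.
    by rewrite -!lee_fin FE cdf_ge0 cdf_le1.
  rewrite (_ : D `&` _ = `]F t, 1[%classic); last first.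
    apply/seteqP; split => u /=; rewrite /D/= !in_itv/= ?andbT.
      by move=> [/andP[_ ->] ->].
    move=> /andP[tu u1]; split => //; rewrite u1 andbT.
    by case/andP: F01 => + _ => /le_lt_trans; apply.
  rewrite lebesgue_measure_itv/= lte_fin.
  rewrite (_ : X @^-1` _ = ~` (X @^-1` `]-oo, t])); last first.
    by apply/seteqP; split => w /=; rewrite !in_itv/= andbT ltNge => /negP.
  rewrite probability_setC; last exact: measurable_funPTI.
  rewrite -[P _]/(cdf (X : {RV P >-> R}) t) -FE -EFinB.
  by case: ltP => // ?; congr EFin; case/andP: F01; lra.
move: A; refine (@measure_unique _ R _ (@RGenOInfty.G R)
    (fun k => `]- k%:R, +oo[%classic) (RGenOInfty.measurableE R) _ _ _
    (push_measure (mrestr (@lebesgue_measure R) mD) mq)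
    (push_measure P (measurable_funP X)) _ _).
- move=> _ _ [x ->] [y ->]; exists (Num.max x y).
  by apply/seteqP; split => z /=; rewrite !in_itv/= !andbT gt_max;
    [case=> -> ->|move/andP].
- by move=> k; eexists.
- apply/seteqP; split => // x _; exists (Num.bound `|x|) => //=.
  rewrite in_itv/= andbT ltrNl (le_lt_trans (ler_norm _))// normrN.
  by rewrite archi_boundP.
- by move=> _ [t ->]; exact: rayE.
- move=> k; rewrite rayE; apply: (@le_lt_trans _ _ 1%E); last exact: ltry.
  by apply: probability_le1; exact: measurable_funPTI.
Qed.

Let ge0_integral_quantile (g : R -> \bar R) : measurable_fun setT g ->
  (forall t, 0 <= g t)%E ->
  (\int[@lebesgue_measure R]_(u in D) g (quantile F u) = \int[P]_w g (X w))%E.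
Proof.
move=> mg g0.
transitivity (\int[@lebesgue_measure R]_(u in D) g (q u))%E.
  by apply: eq_integral => u uD; rewrite /q patchE uD.
rewrite ge0_integral_mrestr//; last exact: measurableT_comp.
transitivity (\int[push_measure (mrestr (@lebesgue_measure R) mD) mq]_t g t)%E.
  by rewrite ge0_integral_pushforward.
transitivity (\int[push_measure P (measurable_funP X)]_t g t)%E.
  by apply: eq_measure_integral => A mA _; exact: quantile_law.
by rewrite ge0_integral_pushforward.
Qed.

(** Splitting both sides into positive and negative parts avoids any integrability hypothesis. *)
Lemma integral_quantile (g : R -> R) : measurable_fun setT g ->
  (\int[@lebesgue_measure R]_(u in `]0%R, 1%R[) (g (quantile F u))%:E =
   \int[P]_w (g (X w))%:E)%E.
Proof.
move=> mg; have mgE : measurable_fun setT (EFin \o g) by exact/measurable_EFinP.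
rewrite integralE [RHS]integralE; congr (_ - _)%E.
  transitivity (\int[@lebesgue_measure R]_(u in D) (EFin \o g)^\+ (quantile F u))%E.
    by apply: eq_integral => u _; rewrite !funeposE.
  rewrite ge0_integral_quantile//; last exact: measurable_funepos.
  by apply: eq_integral => w _; rewrite !funeposE.
transitivity (\int[@lebesgue_measure R]_(u in D) (EFin \o g)^\- (quantile F u))%E.
  by apply: eq_integral => u _; rewrite !funenegE.
rewrite ge0_integral_quantile//; last exact: measurable_funeneg.
by apply: eq_integral => w _; rewrite !funenegE.
Qed.

End QuantileTransform.

(** * Empirical distributions *)

Section EmpiricalQuantile.
Context {R : realType}.
Variables (n : nat) (x : nat -> R).

Let inv_ge0 : 0 <= n.+1%:R^-1 :> R. Proof. by rewrite invr_ge0. Qed.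

Let inv_n : {nonneg R} := NngNum inv_ge0.

(** The sample size is [n.+1], since an empty sample would have total mass [0]. *)
Definition empirical_measure : set R -> \bar R :=
  mscale inv_n (msum (fun j => \d_(x j)) n.+1).

HB.instance Definition _ := Measure.on empirical_measure.

Let empirical_measureE A :
  empirical_measure A = (n.+1%:R^-1 * \sum_(j < n.+1) \1_A (x j))%:E.
Proof.
rewrite /empirical_measure /mscale /= /msum.
rewrite (eq_bigr (fun j : 'I_n.+1 => (\1_A (x j))%:E)) => [|j _].
  by rewrite sumEFin -EFinM.
by [].
Qed.

Let empirical_measure_setT : empirical_measure setT = 1%E.
Proof.
rewrite empirical_measureE; under eq_bigr do rewrite indicT.
by rewrite sumr_const card_ord mulVf.
Qed.

HB.instance Definition _ :=
  Measure_isProbability.Build _ _ _ empirical_measure empirical_measure_setT.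

(** This makes the quantile transform cover empirical distributions, with the identity as random
    variable. *)
Let emp_distr_funE :
  emp_distr_fun n.+1 x = distr_fun empirical_measure (@idfun R).
Proof.
apply/funext => t; rewrite /emp_distr_fun /distr_fun preimage_id.
exact: (esym (congr1 fine (empirical_measureE _))).
Qed.

Let ge0_integral_empirical (g : R -> R) : measurable_fun setT g ->
  (forall t, 0 <= g t) ->
  (\int[empirical_measure]_t (g t)%:E =
   (n.+1%:R^-1 * \sum_(j < n.+1) g (x j))%:E)%E.
Proof.
move=> mg g0; have mgE : measurable_fun setT (EFin \o g) by exact/measurable_EFinP.
rewrite ge0_integral_mscale//=; last by move=> t _; rewrite lee_fin.
rewrite ge0_integral_measure_sum//; last by move=> t _; rewrite lee_fin.
rewrite (eq_bigr (fun j : 'I_n.+1 => (g (x j))%:E)) => [|j _].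
  by rewrite sumEFin -EFinM.
by rewrite /= integral_dirac// diracT mul1e.
Qed.

Lemma integral_empirical_quantile (g : R -> R) : measurable_fun setT g ->
  (\int[@lebesgue_measure R]_(u in `]0%R, 1%R[)
     (g (quantile (emp_distr_fun n.+1 x) u))%:E =
   (n.+1%:R^-1 * \sum_(j < n.+1) g (x j))%:E)%E.
Proof.
move=> mg; have mgE : measurable_fun setT (EFin \o g) by exact/measurable_EFinP.
pose X : {mfun R >-> R} := HB.pack (@idfun R)
  (isMeasurableFun.Build _ _ R R idfun (@measurable_id _ R setT)).
rewrite emp_distr_funE (integral_quantile empirical_measure X mg).
rewrite integralE.
transitivity ((\int[empirical_measure]_t (Num.max (g t) 0)%:E -
    \int[empirical_measure]_t (Num.max (- g t) 0)%:E)%E).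
  by congr (_ - _)%E; apply: eq_integral => t _; rewrite ?funeposE ?funenegE EFin_max.
rewrite !ge0_integral_empirical.
- rewrite -EFinB -mulrBr -sumrB; congr (_ * _)%:E; apply: eq_bigr => j _.
  by case: (ltP (g (x j)) 0) => h; case: (ltP (- g (x j)) 0) => h'; lra.
- by apply: measurable_maxr => //; exact: measurable_funN.
- by move=> t; rewrite le_max lexx orbT.
- exact: measurable_maxr.
- by move=> t; rewrite le_max lexx orbT.
Qed.

End EmpiricalQuantile.
(** * The conjugate function *)

Section FenchelLegendre.
Context {R : realType} (Phi : R -> \bar R).
Hypothesis Phi_adm : admissible_Phi Phi.

Let phi := Phistar Phi.

Let Phi_ge0 x : 0 <= x -> (0 <= Phi x)%E.
Proof. by have [[+ _ _ _ _] _] := Phi_adm; exact. Qed.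

Let conj_set y := [set ((x * y)%:E - Phi x)%E | x in [set x : R | 0 <= x]].

Let Phi_finE x : 0 <= x -> (Phi x < +oo)%E -> exists2 r, 0 <= r & Phi x = r%:E.
Proof.
move=> x0; have := Phi_ge0 x0; case: (Phi x) => // r.
by rewrite lee_fin => r0 _; exists r.
Qed.

(** Superlinearity gives [M] such that [Phi x > |y| x] beyond it, where the terms are negative; up
    to [|M|] they are at most [|M| |y|] because [Phi >= 0]. The point [0] bounds the supremum from
    below. *)
Let conj_set_fin_num y : ereal_sup (conj_set y) \is a fin_num.
Proof.
have [[_ _ _ Phi0 _] [_ Phi_superlinear]] := Phi_adm.
have [c0 c00 Phi0E] := Phi_finE (lexx 0) Phi0.
rewrite fin_numE; apply/andP; split.
  rewrite -ltNye; apply: (@lt_le_trans _ _ (- c0)%:E); first exact: ltNyr.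
  by apply: ereal_sup_ubound; exists 0; rewrite /= ?lexx// mul0r Phi0E -EFinB sub0r.
have /(_ [set z | (`|y|%:E < z)%E]) := Phi_superlinear.
have nu : nbhs (+oo : \bar R)%E [set z | (`|y|%:E < z)%E].
  exact: nbhs_open_ereal_pinfty.
move=> /(_ nu) [M [_ MP]].
rewrite -ltey; apply: (@le_lt_trans _ _ (`|M| * `|y|)%:E); last exact: ltry.
apply: ge_ereal_sup => _ [x /= x0 <-].
have xy : x * y <= x * `|y| by rewrite ler_wpM2l// ler_norm.
have [xM|Mx] := leP x `|M|.
  have := Phi_ge0 x0; case: (Phi x) => [r|//|//]; last by rewrite leNye.
  rewrite lee_fin -EFinB lee_fin => r0.
  have : x * `|y| <= `|M| * `|y| by rewrite ler_wpM2r.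
  by lra.
have Mx' : M < x by rewrite (le_lt_trans (ler_norm M)).
have xp : 0 < x by rewrite (le_lt_trans (normr_ge0 M)).
have My0 : 0 <= `|M| * `|y| by rewrite mulr_ge0.
have /= := MP _ Mx'; have := Phi_ge0 x0; case: (Phi x) => [r|//|//];
  last by rewrite leNye.
rewrite -EFinM !(lee_fin, lte_fin) ltr_pdivlMr// => r0.
by rewrite mulrC; lra.
Qed.

Let phiE y : (phi y)%:E = ereal_sup (conj_set y).
Proof. by rewrite /phi /Phistar fineK //; exact: conj_set_fin_num. Qed.

Let le_phi x r y : 0 <= x -> Phi x = r%:E -> x * y - r <= phi y.
Proof.
move=> x0 xr; rewrite -lee_fin phiE; apply: ereal_sup_ubound.
by exists x => //=; rewrite xr EFinB.
Qed.

Let phi_le y M : (forall x r, 0 <= x -> Phi x = r%:E -> x * y - r <= M) ->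
  phi y <= M.
Proof.
move=> yM; rewrite -lee_fin phiE; apply: ge_ereal_sup => _ [x /= x0 <-].
have := Phi_ge0 x0; case E : (Phi x) => [r|//|//]; last by rewrite leNye.
by move=> _; rewrite -EFinB lee_fin; exact: yM.
Qed.

Lemma Phistar_nondecreasing : {homo phi : y z / y <= z}.
Proof.
move=> y z yz; apply: phi_le => x r x0 xr; apply: le_trans (le_phi z x0 xr).
by rewrite lerD2r ler_wpM2l.
Qed.

(** A supremum of affine functions with nonnegative slopes is lower semicontinuous, and only a
    decrease of [y] can lower it: hence the one-sided neighbourhood. *)
Lemma Phistar_lsc y a : a < phi y ->
  exists2 e, 0 < e & forall z, y - e < z -> a < phi z.
Proof.
move=> ya; have [x [r [x0 xr axr]]] : exists x r,
    [/\ 0 <= x, Phi x = r%:E & a < x * y - r].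
  apply: contrapT => H; move: ya; apply/negP; rewrite -leNgt.
  apply: phi_le => x r x0 xr; rewrite leNgt; apply/negP => axr.
  by apply: H; exists x, r.
(* The gap divided by the slope; [x + 1] keeps the denominator positive and the estimate strict. *)
exists ((x * y - r - a) / (x + 1)); first by rewrite divr_gt0//; lra.
move=> z yz; apply: lt_le_trans (le_phi z x0 xr).
have : x * (y - z) <= x * ((x * y - r - a) / (x + 1)).
  by rewrite ler_wpM2l//; lra.
have : x * ((x * y - r - a) / (x + 1)) < x * y - r - a.
  rewrite mulrA ltr_pdivrMr; last lra.
  by rewrite mulrC ltr_pM2l; lra.
rewrite mulrBr; lra.
Qed.

(** Convexity in the form that fits the Orlicz heart: the factor 2 separates [G] from the shift
    [x]. *)
Lemma Phistar_midpoint y z : phi (y + z) <= (phi (2 * y) + phi (2 * z)) / 2.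
Proof.
apply: phi_le => x r x0 xr.
have := le_phi (2 * y) x0 xr; have := le_phi (2 * z) x0 xr; lra.
Qed.

Lemma Phistar_ge0 y : 0 <= y -> 0 <= phi y.
Proof.
move=> y0; apply: le_trans (Phistar_nondecreasing y0).
apply/ler_addgt0Pr => e e0.
have [_ [inf0 _]] := Phi_adm.
have : (ereal_inf [set Phi x | x in
  [set x : R | (0 <= x)%R]] < e%:E)%E by rewrite inf0 lte_fin.
move=> /ereal_inf_lt[_ [x /= x0 <-] xe].
have [r r0 xr] := Phi_finE x0 (lt_trans xe (ltry _)).
have := le_phi 0 x0 xr; move: xe; rewrite xr lte_fin mulr0; lra.
Qed.

(** Affine minorants from the points [0] and [x0], with the common constant [c = Phi 0 + Phi x0].
    For slope one, compare with slope [x0] when [y >= 0] and with the constant when [y < 0]. *)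
Lemma Phistar_bounds : exists x0 c : R, [/\ 1 < x0, 0 <= c,
  forall y, - c <= phi y, forall y, x0 * y - c <= phi y &
  forall y, y - c <= phi y].
Proof.
have [[_ _ _ Phi0 [x0 x01 Phix0]] _] := Phi_adm.
have [c0 c00 Phi0E] := Phi_finE (lexx 0) Phi0.
have x00 : 0 <= x0 by lra.
have [c1 c10 Phix0E] := Phi_finE x00 Phix0.
have lb y : - (c0 + c1) <= phi y.
  by have := le_phi y (lexx 0) Phi0E; rewrite mul0r; lra.
have lbx y : x0 * y - (c0 + c1) <= phi y.
  by have := le_phi y x00 Phix0E; lra.
exists x0, (c0 + c1); split => //; first lra.
move=> y; have [y0|/ltW y0] := leP 0 y.
  apply: le_trans (lbx y); rewrite lerD2r -[leLHS]mul1r ler_wpM2r//; lra.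
by apply: le_trans (lb y); lra.
Qed.

End FenchelLegendre.

(** * Samples as row vectors *)

Lemma measurable_rV_coord (R : realType) n (i : 'I_n) :
  measurable_fun setT (fun v : Borel_rV R n => (v : 'rV[R]_n) 0 i).
Proof.
apply: (measurability _ (RGenOInfty.measurableE R)) => _ [_ [b ->] <-].
rewrite setTI; apply: sub_sigma_algebra.
have /continuousP := @coord_continuous R 1 n 0 i; apply.
exact: interval_open.
Qed.

Lemma measurable_flatten_row (R : realType) k n (j : 'I_k) :
  measurable_fun setT (fun v : Borel_rV R (k * n) =>
    row j (vec_mx (v : 'rV[R]_(k * n))) : Borel_rV R n).
Proof.
apply: measurable_fun_rV => i.
rewrite (_ : (fun _ => _) = (fun v : Borel_rV R (k * n) =>
    (v : 'rV[R]_(k * n)) 0 (mxvec_index j i))); first exact: measurable_rV_coord.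
by apply/funext => v; rewrite !mxE.
Qed.

Lemma measurable_flatten (R : realType) d (T : measurableType d) k n
  (Y : nat -> T -> Borel_rV R n) : (forall j, measurable_fun setT (Y j)) ->
  measurable_fun setT (fun t => mxvec (\matrix_(j < k, i < n) (Y j t : 'rV[R]_n) 0 i)
    : Borel_rV R (k * n)).
Proof.
move=> mY; apply: measurable_fun_rV => l; case/mxvec_indexP: l => j i.
rewrite (_ : (fun _ => _) = (fun t => (Y j t : 'rV[R]_n) 0 i)).
  exact: (measurableT_comp (@measurable_rV_coord R n i) (mY j)).
by apply/funext => t; rewrite mxvecE mxE.
Qed.

(** * Closure properties of lower semicontinuity *)

Section LscOn.
Context {R : realType} {T : pseudoMetricType R}.
Implicit Types (D : set T) (f g : T -> R).

Lemma lsc_on_EFin D f : (forall t (a : R), D t -> a < f t ->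
    exists2 e : R, 0 < e & forall y, D y -> ball t e y -> a < f y) ->
  lsc_on D (EFin \o f).
Proof.
move=> lf t Dt [a| |]; [|by rewrite ltNge leey|]; last first.
  by move=> _; exists 1 => // y _ _; exact: ltNyr.
by rewrite lte_fin => /(lf t a Dt)[e e0 eP]; exists e => // y Dy ty; rewrite lte_fin eP.
Qed.

Lemma lsc_on_cst D (a : R) : lsc_on D (EFin \o (fun=> a)).
Proof. by move=> t Dt b ba; exists 1. Qed.

Lemma lsc_onD D f g : lsc_on D (EFin \o f) -> lsc_on D (EFin \o g) ->
  lsc_on D (EFin \o (fun t => f t + g t)).
Proof.
move=> lf lg; apply: lsc_on_EFin => t a Dt afg.
have [|e e0 eP] := lf t Dt (f t - (f t + g t - a) / 2)%:E.
  by rewrite lte_fin; lra.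
have [|e' e'0 e'P] := lg t Dt (g t - (f t + g t - a) / 2)%:E.
  by rewrite lte_fin; lra.
exists (Num.min e e'); first by rewrite lt_min e0.
move=> y Dy ty.
have := eP y Dy (le_ball _ ty); have := e'P y Dy (le_ball _ ty).
by rewrite !ge_min !lexx ?orbT !lte_fin => /(_ isT) ? /(_ isT) ?; lra.
Qed.

Lemma lsc_on_sum D k (f : 'I_k -> T -> R) :
  (forall j, lsc_on D (EFin \o f j)) ->
  lsc_on D (EFin \o (fun t => \sum_(j < k) f j t)).
Proof.
elim: k f => [|k ih] f lf.
  rewrite (_ : (fun _ => _) = (fun=> 0)); first exact: lsc_on_cst.
  by apply/funext => t; rewrite big_ord0.
rewrite (_ : (fun _ => _) = (fun t => f ord0 t + \sum_(j < k) f (lift ord0 j) t)).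
  by apply: lsc_onD => //; exact: ih.
by apply/funext => t; rewrite big_ord_recl.
Qed.

Lemma lsc_on_pscale D (k : R) f : 0 < k -> lsc_on D (EFin \o f) ->
  lsc_on D (EFin \o (fun t => k * f t)).
Proof.
move=> k0 lf; apply: lsc_on_EFin => t a Dt; rewrite mulrC -ltr_pdivrMr// => af.
have [|e e0 eP] := lf t Dt (a / k)%:E; first by rewrite lte_fin.
exists e => // y Dy ty; have := eP y Dy ty.
by rewrite lte_fin ltr_pdivrMr// mulrC.
Qed.

End LscOn.

Lemma ereal_inf_pair (R : realType) (S T : Type) (A : set S) (f : S -> T -> \bar R) :
  ereal_inf [set ereal_inf [set f s t | t in setT] | s in A] =
  ereal_inf [set f p.1 p.2 | p in [set p : S * T | A p.1]].
Proof.
apply/eqP; rewrite eq_le; apply/andP; split.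
  apply: le_ereal_inf_tmp => _ [[s t] /= As <-].
  apply: (@le_trans _ _ (ereal_inf [set f s t | t in setT])).
    by apply: ereal_inf_lbound; exists s.
  by apply: ereal_inf_lbound; exists t.
apply: le_ereal_inf_tmp => _ [s As <-]; apply: le_ereal_inf_tmp => _ [t _ <-].
by apply: ereal_inf_lbound; exists (s, t).
Qed.
(** * Mean loss and empirical loss *)

Section RiskFunctional.
Context {R : realType} {m d : nat}.
Variables (PZ : probability (Borel_rV R d) R) (Theta : set 'rV[R]_m).
Variables (G : 'rV[R]_m -> 'rV[R]_d -> R) (phi : R -> R) (x0 c : R).
Variable xi : Borel_rV R d -> R.
Hypothesis phi_nd : {homo phi : y z / y <= z}.
Hypothesis phi_lsc : forall y a, a < phi y ->
  exists2 e, 0 < e & forall z, y - e < z -> a < phi z.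
Hypothesis phi_mid : forall y z, phi (y + z) <= (phi (2 * y) + phi (2 * z)) / 2.
Hypothesis phi_ge0 : forall y, 0 <= y -> 0 <= phi y.
Hypothesis x0_gt1 : 1 < x0.
Hypothesis c_ge0 : 0 <= c.
Hypothesis phi_ge_c : forall y, - c <= phi y.
Hypothesis phi_ge_x0 : forall y, x0 * y - c <= phi y.
Hypothesis phi_ge_id : forall y, y - c <= phi y.
Hypothesis cTheta : compact Theta.
Hypothesis mG : measurable_fun (Theta `*` setT : set (Borel_rV R m * Borel_rV R d))
  (fun p : Borel_rV R m * Borel_rV R d => G p.1 p.2).
Hypothesis lscG : forall z, lsc_on Theta (fun theta => (G theta z)%:E).
Hypothesis int_xi : PZ.-integrable setT (EFin \o xi).
Hypothesis G_le_xi : forall theta z, Theta theta -> `|G theta z| <= xi z.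
Hypothesis heartG : forall theta t, Theta theta -> 0 < t ->
  (\int[PZ]_z (phi (t * `|G theta z|))%:E < +oo)%E.

Definition loss theta x (z : Borel_rV R d) : R := phi (G theta z + x) - x.

Definition mean_loss theta x : R := fine (\int[PZ]_z (loss theta x z)%:E).

Let mphi : measurable_fun setT phi.
Proof. exact: nondecreasing_measurable. Qed.

Let clTheta : closed Theta.
Proof. by apply: compact_closed => //; exact: norm_hausdorff. Qed.

Let mTheta : @measurable _ (Borel_rV R m) Theta.
Proof.
rewrite -(setCK (Theta : set (Borel_rV R m))); apply: measurableC.
by apply: sub_sigma_algebra; exact: closed_openC.
Qed.

Lemma measurable_section theta : Theta theta ->
  measurable_fun setT (fun z : Borel_rV R d => G theta z).
Proof.
move=> th.
apply: (@measurable_comp _ _ _ _ _ _ (Theta `*` setT : set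
  (Borel_rV R m * Borel_rV R d))
  (fun p : Borel_rV R m * Borel_rV R d => G p.1 p.2) _ (fun z => (theta, z))) => //.
- exact: measurableX.
- by move=> _ [z _ <-].
- exact: pair1_measurable.
Qed.

Let mloss theta x : Theta theta -> measurable_fun setT (loss theta x).
Proof.
move=> th; apply: measurable_funB => //; apply: measurableT_comp => //.
by apply: measurable_funD => //; exact: measurable_section.
Qed.

(** Above, monotonicity and the midpoint inequality give half of [phi (2 |G|) + phi (2 |x|)],
    integrable by the Orlicz heart; below, [phi] is at least [- c]. *)
Lemma integrable_loss theta x : Theta theta ->
  PZ.-integrable setT (EFin \o loss theta x).
Proof.
move=> th.
have mphi2 : measurable_fun setT (fun z : Borel_rV R d => phi (2 * `|G theta z|)).
  apply: measurableT_comp => //; apply: measurable_funM => //.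
  by apply: measurableT_comp => //; exact: measurable_section.
have int2 : PZ.-integrable setT (EFin \o (fun z : Borel_rV R d =>
  phi (2 * `|G theta z|))).
  apply/integrableP; split; first exact/measurable_EFinP.
  rewrite (eq_integral (fun z : Borel_rV R d => (phi (2 * `|G theta z|))%:E));
    first exact: heartG.
  by move=> z _; rewrite /= ger0_norm// phi_ge0// mulr_ge0.
pose C := c + `|x| + `|phi (2 * `|x|)|.
have intC : PZ.-integrable setT (EFin \o (fun z : Borel_rV R d =>
  phi (2 * `|G theta z|) + C)).
  have intc : PZ.-integrable setT (EFin \o (fun=> C)) by exact:
    (finite_measure_integrable_cst PZ C).
  exact: (integrableD measurableT int2 intc).
apply: (le_integrable measurableT _ _ intC); first by apply/measurable_EFinP;
  exact: mloss.
move=> z _; rewrite !abse_EFin lee_fin /loss.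
have p2 : 0 <= phi (2 * `|G theta z|) by rewrite phi_ge0// mulr_ge0.
have C0 : 0 <= C by rewrite /C !addr_ge0.
rewrite [leRHS]ger0_norm ?addr_ge0// ler_norml /C.
have := phi_ge_c (G theta z + x); have := ler_norm x; have := lerNnormlW (lexx `|x|).
have := ler_norm (phi (2 * `|x|)); have := normr_ge0 (phi (2 * `|x|)).
have : phi (G theta z + x) <= phi (`|G theta z| + `|x|).
  by apply: phi_nd; rewrite lerD// ler_norm.
have := phi_mid `|G theta z| `|x|.
by move=> *; apply/andP; split; lra.
Qed.

Lemma mean_lossE theta x : Theta theta ->
  (\int[PZ]_z (loss theta x z)%:E = (mean_loss theta x)%:E)%E.
Proof.
by move=> th; rewrite fineK//; exact: integrable_fin_num (integrable_loss x th).
Qed.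

Lemma lsc_on_loss x z : lsc_on Theta (fun theta => (loss theta x z)%:E).
Proof.
move=> theta th [a| |]; [|by rewrite ltNge leey|]; last first.
  by move=> _; exists 1 => // y _ _; exact: ltNyr.
rewrite lte_fin /loss ltrBrDr => /phi_lsc[e e0 eP].
have [|r r0 rP] := @lscG z theta th (G theta z - e)%:E.
  by rewrite lte_fin gtrBl.
exists r => // y thy ty; have := rP y thy ty; rewrite !lte_fin => ey.
by rewrite ltrBrDr; apply: eP; lra.
Qed.

Let r k : R := k.+1%:R^-1.

Let r_gt0 k : 0 < r k. Proof. by rewrite invr_gt0. Qed.

Let r_le1 k : r k <= 1.
Proof. by rewrite /r invf_le1 ?ler1n. Qed.

Let small_r e : 0 < e -> exists k, forall k', (k <= k')%N -> r k' < e.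
Proof.
move=> e0; have [k _ kP] := near_infty_natSinv_lt (PosNum e0).
by exists k => k' kk'; exact: kP.
Qed.

Lemma lsc_on_subset (T : pseudoMetricType R) (A B : set T) (f : T -> \bar R) :
  A `<=` B -> lsc_on B f -> lsc_on A f.
Proof.
move=> AB lf t At b bf; have [e e0 eP] := lf t (AB t At) b bf.
by exists e => // y Ay; apply: eP; exact: AB.
Qed.

(** The slack [r n] turns [inf < b] into the existence of a parameter with [G <= b - r n], to which
    the projection theorem applies. *)
Let measurable_local_inf (K : set 'rV[R]_m) : K !=set0 -> closed K ->
  K `<=` Theta ->
  measurable_fun setT (fun z : Borel_rV R d => inf [set G th z | th in K]).
Proof.
move=> [th0 Kth0] clK KTheta.
have hK z : has_inf [set G th z | th in K].
  split; first by exists (G th0 z), th0.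
  exists (- xi z) => _ [th Kth <-].
  by rewrite lerNl (le_trans (ler_norm _))// normrN G_le_xi//; exact: KTheta.
have cK : compact K by exact: subclosed_compact clK cTheta KTheta.
have mK : @measurable _ (Borel_rV R m) K.
  rewrite -(setCK (K : set (Borel_rV R m))); apply: measurableC.
  by apply: sub_sigma_algebra; exact: closed_openC.
have mGK : measurable_fun (K `*` setT : set (Borel_rV R m * Borel_rV R d))
    (fun p : Borel_rV R m * Borel_rV R d => G p.1 p.2).
  apply: measurable_funS mG; first exact: measurableX.
  by move=> p [Kp _]; split => //; exact: KTheta.
have lGK z : lsc_on K (fun th => (G th z)%:E).
  exact: (lsc_on_subset KTheta (@lscG z)).
apply: (measurability _ (RGenInftyO.measurableE R)) => _ [_ [b ->] <-].
rewrite setTI (_ : _ @^-1` _ =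
    \bigcup_n [set z | exists2 th, K th & G th z <= b - r n]).
  by apply: bigcupT_measurable => n; exact: measurable_exists_lsc_le.
apply/seteqP; split => [z|z [n _ [th Kth thb]]] /=; rewrite in_itv/=.
  move=> infb.
  have e0 : 0 < b - inf [set G th z | th in K] by rewrite subr_gt0.
  have [_ [th Kth <-]] := inf_adherent e0 (hK z).
  rewrite addrC subrK => thb.
  have tb : 0 < b - G th z by rewrite subr_gt0.
  have [k kP] := small_r tb.
  exists k => //; exists th => //; have := kP k (leqnn k); lra.
apply: (@le_lt_trans _ _ (G th z)).
  by apply: ge_inf; [exact: (hK z).2|exists th].
by have := r_gt0 n; lra.
Qed.

Definition mean_gt (a : R) (g : Borel_rV R d -> R) :=
  PZ.-integrable setT (EFin \o g) /\ (a%:E < \int[PZ]_z (g z)%:E)%E.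

Lemma local_lower_bound theta x a : Theta theta -> a < mean_loss theta x ->
  exists2 e, 0 < e & exists2 g, mean_gt a g & forall th y, Theta th ->
    ball theta e th -> `|y - x| < e -> forall z, g z <= loss th y z.
Proof.
move=> thTheta ax.
pose K k := Theta `&` closed_ball theta (r k).
have Ktheta k : K k theta by split => //; exact: closed_ballxx.
pose gamma k z := inf [set G th z | th in K k].
have mgamma k : measurable_fun setT (gamma k : Borel_rV R d -> R).
  apply: measurable_local_inf; first by exists theta.
    by apply: closedI => //; exact: closed_ball_closed.
  by move=> th [].
have hK k z : has_inf [set G th z | th in K k].
  split; first by exists (G theta z), theta.
  exists (- xi z) => _ [th [Tth _] <-].
  by rewrite lerNl (le_trans (ler_norm _))// normrN G_le_xi.
have gamma_le k z th : K k th -> gamma k z <= G th z.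
  by move=> Kth; apply: ge_inf; [exact: (hK k z).2|exists th].
(* The inner [r k] absorbs the change from [x] to [y] inside [phi], the outer one that of the term
   [- x]. *)
pose g k (z : Borel_rV R d) := phi (gamma k z + x - r k) - x - r k.
have mg k : measurable_fun setT (g k).
  apply: measurable_funB => //; apply: measurable_funB => //.
  apply: (measurableT_comp mphi); apply: measurable_funB => //.
  exact: measurable_funD.
have g_le k th y z : Theta th -> ball theta (r k) th -> `|y - x| < r k ->
    g k z <= loss th y z.
  move=> Tth bth yx; rewrite /g /loss.
  have Kth : K k th by split => //; exact: subset_closure.
  have : phi (gamma k z + x - r k) <= phi (G th z + y).
    apply: phi_nd; have := gamma_le k z th Kth.
    by move: yx; rewrite ltr_distlC => /andP[? ?]; lra.
  by move: yx; rewrite ltr_distlC => /andP[? ?]; lra.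
(* [g k] lies between [- c - x - 1] and the loss at the centre, whence the dominating function. *)
pose C := c + `|x| + 1.
pose D (z : Borel_rV R d) := `|loss theta x z| + C.
have intC : PZ.-integrable setT (EFin \o (fun=> C)).
  exact: (finite_measure_integrable_cst PZ C).
have intD : PZ.-integrable setT (EFin \o D).
  have intN := @integrable_norm _ _ _ PZ setT _ (integrable_loss x thTheta).
  exact: (integrableD measurableT intN intC).
have g_dom k z : `|g k z| <= D z.
  have gl : g k z <= loss theta x z.
    by apply: g_le => //; [exact: ballxx|rewrite subrr normr0].
  have := ler_norm (loss theta x z); have := r_gt0 k; have := r_le1 k.
  have := phi_ge_c (gamma k z + x - r k); have := ler_norm x.
  have := normr_ge0 x; have := normr_ge0 (loss theta x z).
  have := c_ge0; rewrite /D /C ler_norml; move: gl; rewrite /g => *.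
  by apply/andP; split; lra.
have intg k : PZ.-integrable setT (EFin \o g k).
  apply: (le_integrable measurableT _ _ intD); first exact/measurable_EFinP.
  move=> z _; rewrite !abse_EFin lee_fin (le_trans (g_dom k z))//.
  exact: ler_norm.
have g_cvg z : (g k z)%:E @[k --> \oo] --> (loss theta x z)%:E.
  apply: cvg_EFin; first by apply: nearW.
  apply/cvgrPdist_le => e e0.
  have phi_e : phi (G theta z + x) - e / 2 < phi (G theta z + x) by lra.
  have [del del0 delP] := phi_lsc phi_e.
  have [|s s0 sP] := @lscG z theta thTheta (G theta z - del / 2)%:E.
    by rewrite lte_fin; lra.
  (* Only a lower estimate is at stake, as [g k'] never exceeds the limit: [del / 2] pays for the
     local infimum of [G], [del / 2] for the inner shift, [e / 2] for the outer one. *)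
  have min0 : 0 < Num.min (s / 2) (Num.min (del / 2) (e / 2)).
    by rewrite !lt_min; apply/and3P; split; lra.
  have [k kP] := small_r min0.
  exists k => // k' /= kk'; have := kP k' kk'; rewrite !lt_min => /and3P[rs rdel re].
  have gl : g k' z <= loss theta x z.
    by apply: g_le => //; [exact: ballxx|rewrite subrr normr0].
  rewrite /= ger0_norm ?subr_ge0// /loss /g.
  have : G theta z - del / 2 <= gamma k' z.
    apply: lb_le_inf; first exact: (hK k' z).1.
    move=> _ [th [Tth cth] <-]; apply: ltW; rewrite -lte_fin; apply: sP => //.
    have rk's : r k' < s by lra.
    exact: closed_ball_subset cth.
  move=> gamma_ge; have /delP : G theta z + x - del < gamma k' z + x - r k' by lra.
  by lra.
have [_ _] := @dominated_convergence _ _ _ PZ setT measurableT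
  (fun k z => (g k z)%:E) (fun z => (loss theta x z)%:E) (fun z => (D z)%:E)
  (fun k => (measurable_EFinP _ _).2 (mg k)) ((measurable_EFinP _ _).2
    (mloss x thTheta))
  (aeW PZ (fun z _ => g_cvg z)) intD
  (aeW PZ (fun z k _ => g_dom k z)).
rewrite mean_lossE// => /(_ [set y | (a%:E < y)%E]).
have nu : nbhs (mean_loss theta x)%:E [set y | (a%:E < y)%E].
  by apply: open_nbhs_nbhs; split; [exact: open_ereal_gt_ereal|rewrite /= lte_fin].
move=> /(_ nu) [k _ /(_ k (leqnn k)) /= kP].
exists (r k) => //; exists (g k); first by split.
by move=> th y Tth bth yx z; exact: g_le.
Qed.

Let xi_int : R := fine (\int[PZ]_z (xi z)%:E).

Let xi_intE : (\int[PZ]_z (xi z)%:E = xi_int%:E)%E.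
Proof. by rewrite fineK//; exact: integrable_fin_num int_xi. Qed.

(** The mean is [a * xi_int + b]; the [- 1] supplies the strict inequality. *)
Let integral_affine_xi a b : mean_gt (a * xi_int + b - 1) (fun z => a * xi z + b).
Proof.
have int1 : PZ.-integrable setT (EFin \o (fun z => a * xi z)).
  exact: (integrableZl measurableT a int_xi).
have int2 : PZ.-integrable setT (EFin \o (fun=> b)).
  exact: (finite_measure_integrable_cst PZ b).
split; first exact: (integrableD measurableT int1 int2).
have -> : (\int[PZ]_z (a * xi z + b)%:E =
    \int[PZ]_z (a * xi z)%:E + \int[PZ]_z b%:E)%E.
  exact: (integralD_EFin measurableT int1 int2).
have -> : (\int[PZ]_z (a * xi z)%:E = a%:E * \int[PZ]_z (xi z)%:E)%E.
  exact: (integralZl measurableT int_xi a).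
rewrite xi_intE integral_cst//= probability_setT mule1 -EFinM -EFinD lte_fin.
by rewrite ltrBlDr ltrDl.
Qed.

(* Both escape directions are controlled: to the right the slope [x0 > 1] of
   the lower bound of [phi] wins over [- x], to the left [phi] is bounded below. *)
Lemma coercive_lower_bound a : exists2 L, 0 < L & exists g1 g2,
  [/\ mean_gt a g1, mean_gt a g2 & forall theta x, Theta theta -> L <= `|x| ->
    (forall z, g1 z <= loss theta x z) \/ (forall z, g2 z <= loss theta x z)].
Proof.
(* The mean of [g1] is [(x0 - 1) * L - x0 * xi_int - c], that of [g2] is [L - c]; both must reach
   [a + 1], one more than [a] to pay for [integral_affine_xi]. *)
pose L := Num.max 1 (Num.max ((a + 1 + x0 * xi_int + c) / (x0 - 1)) (a + 1 + c)).
have [L1 La Lc] : [/\ 1 <= L, (a + 1 + x0 * xi_int + c) /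
  (x0 - 1) <= L & a + 1 + c <= L].
  by rewrite /L !le_max !lexx ?orbT.
have x01 : 0 < x0 - 1 by rewrite subr_gt0.
exists L; first lra.
exists (fun z => - x0 * xi z + ((x0 - 1) * L - c)), (fun z => 0 * xi z + (L - c)).
split.
- have [h1 h2] := integral_affine_xi (- x0) ((x0 - 1) * L - c).
  split => //; apply: le_lt_trans h2; rewrite lee_fin.
  by move: La; rewrite ler_pdivrMr//; lra.
- have [h1 h2] := integral_affine_xi 0 (L - c).
  by split => //; apply: le_lt_trans h2; rewrite lee_fin; lra.
- move=> theta x Ttheta; have [x_ge0|x_lt0] := leP 0 x.
    rewrite ger0_norm// => Lx; left => z; rewrite /loss.
    have := phi_ge_x0 (G theta z + x).
    have : - G theta z <= xi z by rewrite (le_trans (ler_norm _))// normrN G_le_xi.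
    rewrite -(ler_pM2l (_ : 0 < x0)); last lra.
    have : (x0 - 1) * L <= (x0 - 1) * x by rewrite ler_pM2l.
    by lra.
  rewrite ltr0_norm// => Lx; right => z; rewrite /loss.
  by have := phi_ge_c (G theta z + x); lra.
Qed.

Lemma mean_gt_le a g theta x : mean_gt a g -> Theta theta ->
  (forall z, g z <= loss theta x z) -> a < mean_loss theta x.
Proof.
move=> [intg ag] Ttheta gl; rewrite -lte_fin -mean_lossE//.
apply: lt_le_trans ag _; apply: le_integral => //; first exact: integrable_loss.
by move=> z _; rewrite lee_fin.
Qed.

(** Compactness is used as a near-covering along the filter of finite lists ordered by inclusion:
    near each point it is enough that one suitable minorant be listed. Large [|x|] is left to
    [coercive_lower_bound]. *)
Lemma finite_lower_cover (K : set 'rV[R]_m) a : closed K -> K `<=` Theta ->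
  (forall theta x, K theta -> a < mean_loss theta x) ->
  exists s : seq (Borel_rV R d -> R), (forall g, List.In g s -> mean_gt a g) /\
    forall theta x, K theta ->
      exists2 g, List.In g s & forall z, g z <= loss theta x z.
Proof.
move=> clK KTheta aK.
have cK : compact K by exact: subclosed_compact clK cTheta KTheta.
have [L L0 [g1 [g2 [g1a g2a gP]]]] := coercive_lower_bound a.
pose good (s : seq (Borel_rV R d -> R)) := forall g, List.In g s -> mean_gt a g.
pose F := filter_from good (fun s0 => [set s | forall g, List.In g s0 -> List.In g s]).
have FF : Filter F.
  apply: filter_from_filter; first by exists [::].
  move=> s1 s2 gs1 gs2; exists (s1 ++ s2).
    by move=> g /List.in_app_iff[/gs1|/gs2].
  by move=> s h; split => g gs; apply: h; apply/List.in_app_iff; [left|right].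
have cbox : compact (K `*` `[- L, L]%classic).
  by apply: compact_setX => //; exact: segment_compact.
(* Neighbourhoods of a point of the box may leave [Theta], hence the implication. *)
have := (compact_near_coveringP _).1 cbox _ F (fun s p => Theta p.1 ->
  exists2 g, List.In g s & forall z, g z <= loss p.1 p.2 z) FF.
case.
  move=> [theta x] [/= Kth _].
  have [e e0 [g ga gle]] := local_lower_bound (KTheta _ Kth) (aK theta x Kth).
  exists (ball theta e `*` ball x e, [set s | List.In g s]).
    split; first by exists (ball theta e, ball x e) => //; split; exact: nbhsx_ballx.
    by exists [:: g] => [h [<-//|[]]|s sP]; apply: sP; left.
  move=> [[th y] s] [/= [thb yb] gs] Tth; exists g => //.
  by apply: gle => //; rewrite distrC.
move=> s gs sP; exists (g1 :: g2 :: s); split.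
  by move=> g [<-//|[<-//|]]; exact: gs.
move=> theta x Kth; have [Lx|xL] := leP L `|x|.
  by have [h|h] := gP theta x (KTheta _ Kth) Lx;
    [exists g1 => //; left|exists g2 => //; right; left].
have [|g gins gle] := sP s (fun _ => id) (theta, x) _ (KTheta _ Kth).
  split => //=; rewrite in_itv/=; move: xL; rewrite ltr_norml => /andP[? ?].
  by rewrite !ltW.
by exists g => //; right; right.
Qed.

(** Coercivity bounds [x]; [local_lower_bound] makes the mean loss jointly lower semicontinuous, so
    the set is closed. *)
Lemma compact_mean_loss_sublevel (K : set 'rV[R]_m) v : closed K ->
  K `<=` Theta -> compact [set p : 'rV[R]_m * R | K p.1 /\ mean_loss p.1 p.2 <= v].
Proof.
move=> clK KTheta.
have cK : compact K by exact: subclosed_compact clK cTheta KTheta.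
have [L L0 [g1 [g2 [g1a g2a gP]]]] := coercive_lower_bound v.
have cbox : compact (K `*` `[- L, L]%classic).
  by apply: compact_setX => //; exact: segment_compact.
apply: subclosed_compact cbox _; last first.
  move=> [th x] [/= Kth xv]; split => //=.
  have [Lx|] := leP L `|x|.
    have Tth := KTheta _ Kth.
    by have [h|h] := gP th x Tth Lx;
      [have := mean_gt_le g1a Tth h|have := mean_gt_le g2a Tth h]; rewrite ltNge xv.
  by rewrite ltr_norml in_itv/= => /andP[? ?]; rewrite !ltW.
move=> [th x] cl.
have Kth : K th.
  apply: clK => A nA.
  have [|[th' x'] [[/= Kth' _] [/= Ath' _]]] := cl (A `*` setT).
    by exists (A, setT) => //; split => //; exact: filterT.
  by exists th'.
split => //=; rewrite leNgt; apply/negP => vx.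
have [e e0 [g gv gle]] := local_lower_bound (KTheta _ Kth) vx.
have [|[th' x'] [[/= Kth' xv'] [/= bth bx]]] := cl (ball th e `*` ball x e).
  by exists (ball th e, ball x e) => //; split; exact: nbhsx_ballx.
have Tth' := KTheta _ Kth'.
have /(mean_gt_le gv Tth') : forall z, g z <= loss th' x' z.
  by apply: gle => //; rewrite distrC.
by rewrite ltNge xv'.
Qed.

(** The slope one minorant of [phi] cancels the term [- x], so the bound is uniform in [x]. *)
Lemma loss_ge theta x z : Theta theta -> - xi z - c <= loss theta x z.
Proof.
move=> Tth; rewrite /loss; have := phi_ge_id (G theta z + x).
have : - G theta z <= xi z by rewrite (le_trans (ler_norm _))// normrN G_le_xi.
lra.
Qed.

(** Nested compact sublevel sets just above the infimum have a common point. [K] will be [Theta] for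
    the joint problem and a singleton for one fixed parameter. *)
Lemma exists_minimizer (K : set 'rV[R]_m) : K !=set0 -> closed K ->
  K `<=` Theta -> exists theta x, K theta /\
    forall theta' x', K theta' -> mean_loss theta x <= mean_loss theta' x'.
Proof.
move=> [th0 Kth0] clK KTheta.
pose S := [set mean_loss p.1 p.2 | p in [set p : 'rV[R]_m * R | K p.1]].
have hS : has_inf S.
  split; first by exists (mean_loss th0 0), (th0, 0).
  exists (- 1 * xi_int + (- c) - 1) => _ [[th x] /= Kth <-]; apply: ltW.
  apply: (mean_gt_le (integral_affine_xi (- 1) (- c)) (KTheta _ Kth)) => z.
  by rewrite mulN1r; apply: loss_ge; exact: KTheta.
pose A k := [set p : 'rV[R]_m * R | K p.1 /\ mean_loss p.1 p.2 <= inf S + r k].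
have cA k : compact (A k) by exact: compact_mean_loss_sublevel.
have [| | |[th x] Ap] := @nested_compact_nonempty _ A (cA 0%N).
- by move=> k; apply: compact_closed; [exact: norm_hausdorff|exact: cA].
- move=> k [th x] [Kth h]; split => //; apply: le_trans h _; rewrite lerD2l.
  by rewrite /r lef_pV2 ?posrE// ler_nat.
- move=> k; have [_ [[th x] /= Kth <-] lt] := inf_adherent (r_gt0 k) hS.
  by exists (th, x); split => //; exact: ltW.
exists th, x; have [/= Kth _] := Ap 0%N I; split => // th' x' Kth'.
apply: (@le_trans _ _ (inf S)); last first.
  by apply: ge_inf; [exact: hS.2|exists (th', x')].
apply/ler_addgt0Pr => e e0; have [k kP] := small_r e0.
have [_ /=] := Ap k I; have := kP k (leqnn k); lra.
Qed.

(** * Empirical infima *)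

Section EmpiricalRisk.
Context {dO : measure_display} {Omega : measurableType dO}.
Variables (P : probability Omega R) (Z : nat -> Omega -> Borel_rV R d).
Hypothesis mZ : forall i, measurable_fun setT (Z i).
Hypothesis indepZ : mutually_independent P Z.
Hypothesis lawZ : forall i (B : set (Borel_rV R d)), measurable B ->
  P (Z i @^-1` B) = PZ B.
Hypothesis Theta0 : Theta !=set0.

Definition emp_loss n theta x w : R :=
  n%:R^-1 * \sum_(j < n) loss theta x (Z j w).

Definition emp_min_loss n w : \bar R :=
  ereal_inf [set (emp_loss n p.1 p.2 w)%:E | p in [set p : 'rV[R]_m * R | Theta p.1]].

Let avg_le n (f g : Borel_rV R d -> R) w : (forall z, f z <= g z) ->
  n%:R^-1 * \sum_(j < n) f (Z j w) <= n%:R^-1 * \sum_(j < n) g (Z j w).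
Proof.
by move=> fg; rewrite ler_wpM2l ?invr_ge0//; apply: ler_sum => j _; exact: fg.
Qed.

Lemma emp_min_loss_fin_num n w : emp_min_loss n w \is a fin_num.
Proof.
have [th0 Tth0] := Theta0.
rewrite fin_numElt; apply/andP; split.
  apply: (@lt_le_trans _ _ (n%:R^-1 * \sum_(j < n) (- xi (Z j w) - c))%:E).
    exact: ltNyr.
  apply: le_ereal_inf_tmp => _ [[th x] /= Tth <-]; rewrite lee_fin.
  by apply: (@avg_le n (fun z => - xi z - c) (loss th x) w) => z; exact: loss_ge.
apply: (@le_lt_trans _ _ (emp_loss n th0 0 w)%:E); last exact: ltry.
by apply: ereal_inf_lbound; exists (th0, 0).
Qed.

Let sample n w : Borel_rV R (n * d) :=
  mxvec (\matrix_(j < n, i < d) (Z j w : 'rV[R]_d) 0 i).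

(** The loss is factored through [sample] because the projection theorem needs a Euclidean space,
    while [Omega] is arbitrary. *)
Let sample_loss n x theta (y : 'rV[R]_(n * d)) : R :=
  n%:R^-1 * \sum_(j < n) loss theta x (row j (vec_mx y)).

Let sample_lossE n x theta w : sample_loss x theta (sample n w) = emp_loss n theta x w.
Proof.
rewrite /sample_loss /emp_loss; congr (_ * _); apply: eq_bigr => j _.
congr (loss _ _ _); rewrite /sample mxvecK; apply/rowP => i.
by rewrite !mxE.
Qed.

Let measurable_sample_loss n x :
  measurable_fun (Theta `*` setT : set (Borel_rV R m * Borel_rV R (n * d)))
    (fun p : Borel_rV R m * Borel_rV R (n * d) => sample_loss x p.1 p.2).
Proof.
apply: measurable_funM => //; apply: measurable_sum => j.
apply: measurable_funB => //; apply: (measurableT_comp mphi).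
apply: measurable_funD => //.
apply: (@measurable_comp _ _ _ _ _ _ (Theta `*` setT : set
  (Borel_rV R m * Borel_rV R d))
  (fun p : Borel_rV R m * Borel_rV R d => G p.1 p.2) _
  (fun p : Borel_rV R m * Borel_rV R (n * d) =>
    (p.1, row j (vec_mx (p.2 : 'rV[R]_(n * d))) : Borel_rV R d))).
- exact: measurableX.
- by move=> _ [p [Tp _] <-].
- exact: mG.
- apply: measurable_funTS; apply/measurable_fun_pairP; split => /=.
    exact: measurable_fst.
  exact: (measurableT_comp (@measurable_flatten_row R n d j) measurable_snd).
Qed.

Let lsc_on_sample_loss n x (y : 'rV[R]_(n * d)) : (0 < n)%N ->
  lsc_on Theta (fun theta => (sample_loss x theta y)%:E).
Proof.
move=> n0; apply: lsc_on_pscale; first by rewrite invr_gt0 ltr0n.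
by apply: lsc_on_sum => j; exact: lsc_on_loss.
Qed.

Lemma measurable_emp_min_loss n : (0 < n)%N ->
  measurable_fun setT (emp_min_loss n).
Proof.
move=> n0.
apply: (measurability _ (ErealGenInftyO.measurableE R)) => _ [_ [b ->] <-].
rewrite setTI (_ : _ @^-1` _ = \bigcup_(q : rat) \bigcup_k (sample n @^-1`
    [set y | exists2 th, Theta th & sample_loss (ratr q) th y <= b - r k])).
  apply: countable_bigcupT_measurable; first exact: countableP.
  move=> q.
  apply: bigcupT_measurable => k; rewrite -[X in measurable X]setTI.
  apply: (measurable_flatten mZ) => //.
  by apply: measurable_exists_lsc_le => // y; exact: lsc_on_sample_loss.
apply/seteqP; split => [w|w [q _ [k _ [th Tth thb]]]] /=; rewrite in_itv/=.
  move=> /ereal_inf_lt[_ [[th x] /= Tth <-]]; rewrite lte_fin => thb.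
  have e0 : 0 < (b - emp_loss n th x w) / 2 by lra.
  have [k kP] := small_r e0; have rk := kP k (leqnn k).
  (* A rational just left of [x]: lowering the shift does not raise [phi], and the linear term costs
     less than half of the gap; [r k] is below the other half. *)
  have [q] := @rat_in_itvoo R (x - (b - emp_loss n th x w) / 2) x ltac:(lra).
  rewrite in_itv/= => /andP[xq qx].
  exists q => //; exists k => //; exists th => //; rewrite sample_lossE.
  have : emp_loss n th (ratr q) w <= emp_loss n th x w + (x - ratr q).
    have -> : emp_loss n th x w + (x - ratr q) =
        n%:R^-1 * \sum_(j < n) (loss th x (Z j w) + (x - ratr q)).
      rewrite big_split/= sumr_const card_ord mulrDr -(mulr_natl
        (x - ratr q)) mulrA mulVf ?mul1r//.
      by rewrite pnatr_eq0 -lt0n.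
    apply: (@avg_le n (loss th (ratr q)) (fun z => loss th x z + (x - ratr q)) w) => z.
    rewrite /loss; have : phi (G th z + ratr q) <= phi (G th z + x).
      by apply: phi_nd; rewrite lerD2l ltW.
    by lra.
  by lra.
apply: (@le_lt_trans _ _ (emp_loss n th (ratr q) w)%:E).
  by apply: ereal_inf_lbound; exists (th, ratr q).
by rewrite lte_fin -sample_lossE (le_lt_trans thb)//; have := r_gt0 k; lra.
Qed.

Let ae_avg_gt a (s : seq (Borel_rV R d -> R)) :
  (forall g, List.In g s -> mean_gt a g) ->
  {ae P, forall w, \forall n \near \oo, forall g, List.In g s ->
    a < n%:R^-1 * \sum_(j < n) g (Z j w)}.
Proof.
elim: s => [|g s ih] sa; first by apply: aeW => w; apply: nearW.
have [intg ag] := sa g (or_introl erefl).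
have ih' := ih (fun g' g's => sa g' (or_intror g's)).
have := strong_law_gt mZ indepZ lawZ intg ag; apply: filterS2 ih' => w.
by apply: filterS2 => n sP gP g' [<-//|]; exact: sP.
Qed.

Lemma emp_min_loss_cvg v theta x : Theta theta -> mean_loss theta x = v ->
  (forall th y, Theta th -> v <= mean_loss th y) ->
  {ae P, forall w, emp_min_loss n w @[n --> \oo] --> v%:E}.
Proof.
move=> Tth thv vle.
have low k : {ae P, forall w, \forall n \near \oo,
  ((v - r k)%:E <= emp_min_loss n w)%E}.
  (* [v - r k] is strictly below every mean loss, as the covering lemma requires. *)
  have [|s [sa sP]] := @finite_lower_cover Theta (v - r k) clTheta (fun _ => id).
    by move=> th y Tth'; have := vle th y Tth'; have := r_gt0 k; lra.
  apply: filterS (ae_avg_gt sa) => w; apply: filterS => n nP.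
  apply: le_ereal_inf_tmp => _ [[th y] /= Tth' <-]; rewrite lee_fin.
  have [g gs gle] := sP th y Tth'.
  by rewrite (le_trans (ltW (nP g gs)))//; exact: avg_le.
have upp k : {ae P, forall w, \forall n \near \oo, (emp_min_loss n w <=
  (v + r k)%:E)%E}.
  have lt : (\int[PZ]_z (loss theta x z)%:E < (v + r k)%:E)%E.
    by rewrite mean_lossE// thv lte_fin ltrDl.
  have := strong_law_lt mZ indepZ lawZ (integrable_loss x Tth) lt.
  apply: filterS => w; apply: filterS => n nP.
  apply: (@le_trans _ _ (emp_loss n theta x w)%:E); last by rewrite lee_fin ltW.
  by apply: ereal_inf_lbound; exists (theta, x).
have := (ae_foralln low, ae_foralln upp).
move=> [lowP uppP]; apply: filterS2 lowP uppP => w wlow wupp.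
rewrite (_ : (fun n => emp_min_loss n w) = EFin \o (fun n => fine (emp_min_loss n w))).
  apply: cvg_EFin; first by apply: nearW.
  apply/cvgrPdist_le => e e0; have [k kP] := small_r e0.
  have ke := kP k (leqnn k).
  apply: filterS2 (wlow k) (wupp k) => n.
  rewrite -(fineK (emp_min_loss_fin_num n w)) !lee_fin /= => h1 h2.
  by rewrite ler_distlC; apply/andP; split; lra.
by apply/funext => n /=; rewrite fineK// emp_min_loss_fin_num.
Qed.

End EmpiricalRisk.

End RiskFunctional.

(** * From the risk to the mean loss, and the theorem *)

Lemma measurable_Phistar_shift (R : realType) (Phi : R -> \bar R) (x : R) :
  admissible_Phi Phi -> measurable_fun setT (fun y : R => Phistar Phi (y + x)).
Proof.
move=> adm; apply: nondecreasing_measurable => // y z yz.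
by apply: Phistar_nondecreasing => //; rewrite lerD2r.
Qed.

Lemma risk_obj_distr_fun (R : realType) d (T : measurableType d)
  (P : probability T R) (X : {mfun T >-> R}) (Phi : R -> \bar R) x :
  admissible_Phi Phi -> risk_obj Phi (distr_fun P X) x =
  (\int[P]_w (Phistar Phi (X w + x))%:E - x%:E)%E.
Proof.
move=> adm; rewrite /risk_obj.
by rewrite (integral_quantile P X (measurable_Phistar_shift x adm)).
Qed.

Lemma risk_obj_emp_distr_fun (R : realType) n (y : nat -> R)
  (Phi : R -> \bar R) x : admissible_Phi Phi ->
  risk_obj Phi (emp_distr_fun n.+1 y) x =
  (n.+1%:R^-1 * \sum_(j < n.+1) (Phistar Phi (y j + x) - x))%:E.
Proof.
move=> adm; rewrite /risk_obj.
rewrite (integral_empirical_quantile n y (measurable_Phistar_shift x adm)).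
rewrite -EFinB sumrB sumr_const card_ord mulrBr -(mulr_natl x) mulrA mulVf ?mul1r//.
Qed.

(* Z i stands for Z_{i+1}; G is given on R^m x R^d, only its values on
   Theta x R^d matter. *)
Theorem theorem3p1 (R : realType) (dO : measure_display)
  (Omega : measurableType dO) (P : probability Omega R)
  (m d : nat) (Theta : set 'rV[R]_m)
  (Z : nat -> Omega -> Borel_rV R d) (PZ : probability (Borel_rV R d) R)
  (G : 'rV[R]_m -> 'rV[R]_d -> R) (Phi : R -> \bar R) :
  atomless P ->
  Theta !=set0 -> compact Theta ->
  (forall i, measurable_fun setT (Z i)) ->
  mutually_independent P Z ->
  (forall i (B : set (Borel_rV R d)), measurable B -> P (Z i @^-1` B) = PZ B) ->
  admissible_Phi Phi ->
  (* (A1) *)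
  measurable_fun (Theta `*` setT : set (Borel_rV R m * Borel_rV R d))
    (fun p : Borel_rV R m * Borel_rV R d => G p.1 p.2) ->
  (forall z : 'rV[R]_d, lsc_on Theta (fun theta => (G theta z)%:E)) ->
  (* (A2) *)
  (exists xi1 : Borel_rV R d -> R, PZ.-integrable setT (EFin \o xi1) /\
     forall z, (ereal_sup [set `|G theta z|%:E | theta in Theta] <= (xi1 z)%:E)%E) ->
  (* (A3) *)
  (forall theta, Theta theta -> orlicz_heart P Phi (fun w => G theta (Z 0%N w))) ->
  (exists xi2 : Borel_rV R d -> R, PZ.-integrable setT (EFin \o xi2) /\
     forall z, (ereal_sup [set `|Phistar Phi (G theta z)|%:E | theta in Theta]
                 <= (xi2 z)%:E)%E) ->
  let F theta := distr_fun P (fun w => G theta (Z 0%N w)) in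
  let Fhat n theta w := emp_distr_fun n (fun j => G theta (Z j w)) in
  let Vstar := ereal_inf [set risk Phi (F theta) | theta in Theta] in
  let Vhat n w := ereal_inf [set risk Phi (Fhat n theta w) | theta in Theta] in
  let argminR := [set theta | Theta theta /\ risk Phi (F theta) = Vstar] in
  (* 1) *)
  (forall n : nat, (0 < n)%N ->
     (forall w, (Vhat n w - Vstar)%E \is a fin_num) /\
     measurable_fun setT (fun w => ((Vhat n w - Vstar)%E : \bar R))) /\
  (* 2) *)
  (argminR !=set0 /\ compact argminR /\
   forall theta, Theta theta ->
     minimizers Phi (F theta) !=set0 /\ compact (minimizers Phi (F theta))) /\
  (* 3) *)
  (exists A : set Omega, [/\ measurable A, P A = 1%E &
     forall w, A w -> (fun n : nat => Vhat n.+1 w) @ \oo --> Vstar]).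
Proof.
move=> _ Theta0 cTheta mZ indepZ lawZ adm mG lscG [xi [int_xi xiP]] heart _.
move=> F Fhat Vstar Vhat argminR.
have [x0 [c [x01 c0 phi_ge_c phi_ge_x0 phi_ge_id]]] := Phistar_bounds adm.
set phi := Phistar Phi in phi_ge_c phi_ge_x0 phi_ge_id.
have phi_nd : {homo phi : y z / y <= z} := Phistar_nondecreasing adm.
have phi_lsc := Phistar_lsc adm.
have phi_mid := Phistar_midpoint adm.
have phi_ge0 := Phistar_ge0 adm.
have mphi : measurable_fun setT phi by exact: nondecreasing_measurable.
have G_le_xi theta z : Theta theta -> `|G theta z| <= xi z.
  move=> Tth; rewrite -lee_fin; apply: le_trans (xiP z).
  by apply: ereal_sup_ubound; exists theta.
have mGth := measurable_section cTheta mG.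
(* The Orlicz heart is stated on [Omega], the mean loss on the law [PZ]; this moves between them. *)
have integral_Z0 (g : Borel_rV R d -> \bar R) : measurable_fun setT g ->
    (forall z, 0 <= g z)%E -> (\int[PZ]_z g z = \int[P]_w g (Z 0%N w))%E.
  move=> mg g0; transitivity (\int[push_measure P (mZ 0%N)]_z g z)%E.
    by apply: eq_measure_integral => B mB _; exact/esym/lawZ.
  by rewrite ge0_integral_pushforward.
have heartG theta t : Theta theta -> 0 < t ->
    (\int[PZ]_z (phi (t * `|G theta z|))%:E < +oo)%E.
  move=> Tth t0; rewrite integral_Z0.
  - by have [_] := heart theta Tth; exact.
  - apply/measurable_EFinP; apply: (measurableT_comp mphi).
    apply: measurable_funM => //; apply: measurableT_comp => //.
    exact: mGth.
  - by move=> z; rewrite lee_fin phi_ge0// mulr_ge0// ltW.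
pose ml := mean_loss PZ G phi.
have int_loss := integrable_loss phi_nd phi_mid phi_ge0 c0 phi_ge_c cTheta mG heartG.
have mlE := mean_lossE phi_nd phi_mid phi_ge0 c0 phi_ge_c cTheta mG heartG.
have FE theta x : Theta theta -> risk_obj Phi (F theta) x = (ml theta x)%:E.
  move=> Tth; pose X : {mfun Borel_rV R d >-> R} :=
    HB.pack (G theta : Borel_rV R d -> R)
    (isMeasurableFun.Build _ _ (Borel_rV R d) R (G theta) (mGth theta Tth)).
  have -> : F theta = distr_fun PZ X.
    apply/funext => t; rewrite /F /distr_fun; congr fine.
    rewrite -[LHS]/(P (Z 0%N @^-1` (X @^-1` `]-oo, t]))); apply: lawZ.
    exact: measurable_funPTI.
  rewrite risk_obj_distr_fun// /ml -(mlE theta x Tth).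
  (* [risk_obj] subtracts [x] outside the integral, [loss] inside; under a probability the constant
     [x] has mean [x]. *)
  have int_x : PZ.-integrable setT (EFin \o (fun=> x)).
    exact: (finite_measure_integrable_cst PZ x).
  have -> : (\int[PZ]_z (Phistar Phi (X z + x))%:E =
      \int[PZ]_z (loss G phi theta x z + x)%:E)%E.
    by apply: eq_integral => z _; rewrite /loss subrK.
  have -> : (\int[PZ]_z (loss G phi theta x z + x)%:E =
      \int[PZ]_z (loss G phi theta x z)%:E + \int[PZ]_z x%:E)%E.
    exact: (integralD_EFin measurableT (int_loss theta x Tth) int_x).
  by rewrite integral_cst//= probability_setT mule1 mlE// addeK.
have FhatE n theta x w : risk_obj Phi (Fhat n.+1 theta w) x =
    (emp_loss G phi Z n.+1 theta x w)%:E.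
  exact: risk_obj_emp_distr_fun.
have VhatE n w : Vhat n.+1 w = emp_min_loss Theta G phi Z n.+1 w.
  rewrite /Vhat /emp_min_loss -(ereal_inf_pair Theta (fun th x =>
    (emp_loss G phi Z n.+1 th x w)%:E)).
  congr ereal_inf; apply: eq_imagel => theta _; rewrite /risk.
  by congr ereal_inf; apply: eq_imagel => x _; exact: FhatE.
have clTheta : closed Theta by apply: compact_closed => //; exact: norm_hausdorff.
have minP := exists_minimizer phi_nd phi_lsc phi_mid phi_ge0 x01 c0 phi_ge_c
  phi_ge_x0 phi_ge_id cTheta mG lscG int_xi G_le_xi heartG.
have [th1 [x1 [Tth1 th1min]]] := minP Theta Theta0 clTheta (fun _ => id).
pose v := ml th1 x1.
have risk_le theta x : Theta theta -> (risk Phi (F theta) <= (ml theta x)%:E)%E.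
  by move=> Tth; apply: ereal_inf_lbound; exists x => //; rewrite FE.
have le_risk theta b : Theta theta -> (forall x, b <= ml theta x) ->
    (b%:E <= risk Phi (F theta))%E.
  move=> Tth bml; apply: le_ereal_inf_tmp => _ [x _ <-].
  by rewrite FE// lee_fin.
have VstarE : Vstar = v%:E.
  apply/eqP; rewrite eq_le; apply/andP; split.
    apply: (@le_trans _ _ (risk Phi (F th1))); last exact: risk_le.
    by apply: ereal_inf_lbound; exists th1.
  apply: le_ereal_inf_tmp => _ [theta Tth <-]; apply: le_risk => // x.
  exact: th1min.
have compact_sub K b : closed K -> K `<=` Theta ->
    compact [set p : 'rV[R]_m * R | K p.1 /\ ml p.1 p.2 <= b].
  exact: (compact_mean_loss_sublevel phi_nd phi_lsc phi_mid phi_ge0 x01 c0 phi_ge_c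
    phi_ge_x0 cTheta mG lscG int_xi G_le_xi heartG).
(* The existence lemma on the singleton of [theta] shows that the infimum over [x] is attained. *)
have argmin1 theta : Theta theta -> exists2 x, risk Phi (F theta) = (ml theta x)%:E &
    forall y, ml theta x <= ml theta y.
  move=> Tth.
  have [||th' [x [/= -> xmin]]] := minP [set theta] (ex_intro _ theta erefl).
  - by apply: compact_closed; [exact: norm_hausdorff|exact: compact_set1].
  - by move=> _ ->.
  have xmin' y : ml theta x <= ml theta y by exact: xmin.
  exists x => //; apply/eqP; rewrite eq_le (risk_le theta x Tth) /=.
  exact: le_risk.
split; [|split; [split; [|split]|]].
- case=> // n _; split.
    move=> w; rewrite VhatE VstarE fin_numB/= andbT.
    exact: (emp_min_loss_fin_num phi_ge_id G_le_xi).
  rewrite VstarE; apply: emeasurable_funB; last exact: measurable_cst.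
  have -> : Vhat n.+1 = emp_min_loss Theta G phi Z n.+1.
    by apply/funext => w; exact: VhatE.
  exact: (measurable_emp_min_loss phi_nd phi_lsc cTheta mG lscG mZ).
- exists th1; split => //; apply/eqP; rewrite eq_le VstarE (risk_le th1 x1 Tth1) /=.
  by apply: le_risk => // x; exact: th1min.
(* As the infimum over [x] is attained, [theta] is optimal iff it is the first coordinate of a joint
   minimizer; the image of a compact set under the projection is compact. *)
- rewrite (_ : argminR = fst @` [set p : 'rV[R]_m * R | Theta p.1 /\ ml p.1 p.2 <= v]).
    apply: continuous_compact; last exact: compact_sub.
    by apply: continuous_subspaceT => p; exact: cvg_fst.
  apply/seteqP; split => [theta [Tth thV]|_ [[theta x] /= [Tth xv] <-]].
    have [x xE _] := argmin1 theta Tth; exists (theta, x) => //; split => //=.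
    by rewrite -lee_fin -xE thV VstarE.
  split => //; apply/eqP; rewrite eq_le VstarE.
  rewrite (le_trans (risk_le theta x Tth)) ?lee_fin//=.
  by apply: le_risk => // y; exact: th1min.
- move=> theta Tth; have [x xE xmin] := argmin1 theta Tth; split.
    by exists x; rewrite /minimizers /= FE.
  (* The same argument, with the singleton of [theta] and the second projection. *)
  rewrite (_ : minimizers _ _ = snd @`
      [set p : 'rV[R]_m * R | [set theta] p.1 /\ ml p.1 p.2 <= ml theta x]).
    apply: continuous_compact.
      by apply: continuous_subspaceT => p; exact: cvg_snd.
    apply: compact_sub => [|_ -> //].
    by apply: compact_closed; [exact: norm_hausdorff|exact: compact_set1].
  apply/seteqP; split => [y|_ [[th' y] /= [-> yx] <-]]; rewrite /minimizers /= FE// xE.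
    by move=> [yE]; exists (theta, y) => //=; rewrite yE.
  by congr EFin; apply/eqP; rewrite eq_le yx xmin.
- have := emp_min_loss_cvg phi_nd phi_lsc phi_mid phi_ge0 x01 c0 phi_ge_c
    phi_ge_x0 phi_ge_id cTheta mG lscG int_xi G_le_xi heartG mZ indepZ lawZ Theta0
    Tth1 (erefl v) (fun th y => th1min th y).
  (* [N] is a measurable null set containing the exceptional set, which itself need not be
     measurable. *)
  case=> N [mN PN NP]; exists (~` N); split.
  + exact: measurableC.
  + by rewrite probability_setC// PN sube0.
  + move=> w Nw; rewrite VstarE.
    have wcvg : emp_min_loss Theta G phi Z n w @[n --> \oo] --> v%:E.
      by apply: contrapT => nw; apply: Nw; exact: NP.
    rewrite (_ : (fun n => _) = (fun n => emp_min_loss Theta G phi Z n.+1 w)).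
      by rewrite -cvg_shiftS in wcvg.
    by apply/funext => n; exact: VhatE.
Qed.
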